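(* Let $A$ be a finite alphabet, $F_A$ the free group on $A$, and let $H\leqslant K\leqslant F_A$ be subgroups with $H$ finitely generated. Let $\mathcal{C}l_K(H)$, $f\mathcal{OC}l_K(H)$ and $\mathcal{OC}l_K(H)$ be the $K$-algebraic closure, the $K$-fully onto closure and the $K$-onto closure of $H$, respectively. Then $$H\leqslant \mathcal{C}l_K(H)\leqslant f\mathcal{OC}l_K(H)\leqslant \mathcal{OC}l_K(H)\leqslant K,$$ where: the extension $H\leqslant\mathcal{C}l_K(H)$ is algebraic; the extension $\mathcal{C}l_K(H)\leqslant f\mathcal{OC}l_K(H)$ is fully onto, and $\mathcal{C}l_K(H)$ is a free factor of $f\mathcal{OC}l_K(H)$; the extension $f\mathcal{OC}l_K(H)\leqslant\mathcal{OC}l_K(H)$ is onto, and $f\mathcal{OC}l_K(H)$ is a free factor of $\mathcal{OC}l_K(H)$; and $\mathcal{OC}l_K(H)$ is a free factor of $K$.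
   Context: Stallings automata. Let $F$ be a free group with basis $C$. An involutive $C$-automaton is a directed graph (loops and parallel edges allowed) with edges labelled by elements of $C\cup C^{-1}$, with a distinguished vertex $\circledcirc$ (the basepoint), in which every edge $e$ from $p$ to $q$ labelled $c$ has an inverse edge $e^{-1}$ from $q$ to $p$ labelled $c^{-1}$. It is deterministic if no two different edges with the same label start (or end) at the same vertex. A path is reduced if it never crosses an edge immediately followed by its inverse. The automaton is trim if every vertex and edge appears in some reduced closed path at $\circledcirc$. A Stallings $C$-automaton is a connected, deterministic, trim involutive $C$-automaton. For each subgroup $H\leqslant F$ there is a unique (up to isomorphism) Stallings $C$-automaton $\Gamma_C(H)$ such that the set of labels of reduced closed paths at $\circledcirc$, read in $F$, is exactly $H$. A $C$-homomorphism between $C$-automata is a map sending vertices to vertices and edges to edges, preserving incidence, labels and basepoint. It is onto if it is surjective both on vertices and on edges. For $H\leqslant K\leqslant F$ there is a unique $C$-homomorphism $\theta_{H,K}\colon \Gamma_C(H)\to\Gamma_C(K)$. Let $H\leqslant K\leqslant F_A$. A free factor of $K$ is a subgroup having a basis that extends to a basis of $K$. - $H\leqslant K$ is algebraic if $H$ is not contained in any proper free factor of $K$. - $H\leqslant K$ is onto if $\theta_{H,K}\colon\Gamma_{A'}(H)\to\Gamma_{A'}(K)$ is onto for every basis $A'$ of $F_A$. - $H\leqslant K$ is fully onto if, for every (possibly infinite) alphabet $B\supseteq A$ and every basis $B'$ of $F_B\geqslant F_A$, $\theta_{H,K}\colon\Gamma_{B'}(H)\to\Gamma_{B'}(K)$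 is onto. Closures, for $H\leqslant K\leqslant F_A$ with $H$ finitely generated: - $\mathcal{C}l_K(H)$ is the unique subgroup $L$ with $H\leqslant L\leqslant K$ such that $H\leqslant L$ is algebraic and $L$ is a free factor of $K$; it is known to exist and to be both the smallest free factor of $K$ containing $H$ and the largest algebraic extension of $H$ contained in $K$. - $\mathcal{OC}l_K(H)$ is the subgroup generated by all the onto extensions of $H$ contained in $K$; it is the largest onto extension of $H$ contained in $K$. - $f\mathcal{OC}l_K(H)$ is the subgroup generated by all the fully onto extensions of $H$ contained in $K$; it is the largest fully onto extension of $H$ contained in $K$. *)

(* Defs.v *)
From mathcomp Require Import all_boot.
From mathcomp Require Import boolp classical_sets cardinality.

Set Implicit Arguments.
Unset Strict Implicit.
Unset Printing Implicit Defensive.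

Local Open Scope classical_set_scope.
Local Open Scope group_scope.

Section Subgroups.
Variable G : groupType.
Implicit Types X Y H K L : set G.

Definition is_subgroup H : Prop :=
  [/\ H 1, forall x y, H x -> H y -> H (x * y) & forall x, H x -> H x^-1].

Definition generated X : set G := smallest is_subgroup X.

Definition finitely_generated H : Prop :=
  exists2 X, finite_set X & generated X = H.

(* H <= K *)
Definition extension H K : Prop := [/\ is_subgroup H, is_subgroup K & H `<=` K].

(* Letters carry a formal sign: if x and x^-1 were distinct elements of X, the
   word (x, true) (x^-1, true) would be reduced, so X would not be free. *)
Definition letter_val (l : G * bool) : G := if l.2 then l.1 else l.1^-1.

Definition reduced_word (w : seq (G * bool)) : bool :=
  sorted (fun l l' => l' != (l.1, ~~ l.2)) w.

Definition free_set X : Prop :=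
  forall w : seq (G * bool), {in w, forall l, X l.1} -> reduced_word w ->
    \prod_(l <- w) letter_val l = 1 -> w = [::].

Definition is_basis X H : Prop := free_set X /\ generated X = H.

Definition free_factor L K : Prop :=
  exists X Y, [/\ is_basis X L, is_basis Y K & X `<=` Y].

Definition algebraic H K : Prop :=
  extension H K /\ forall L, free_factor L K -> H `<=` L -> L = K.

End Subgroups.

(* Labels are group elements; [involutive_automaton C] forces them to lie in
   C and C^-1, the inverse letter being the inverse in the group. *)
Record automaton (G : groupType) := Automaton {
  vertex : Type;
  edge : Type;
  src : edge -> vertex;
  tgt : edge -> vertex;
  label : edge -> G;
  einv : edge -> edge;
  base : vertex }.

Section Automata.
Variables (G : groupType) (C : set G).

Definition involutive_automaton (T : automaton G) : Prop :=
  forall e : edge T,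
    [/\ C (label e) \/ C (label e)^-1,
        src (einv e) = tgt e, tgt (einv e) = src e,
        label (einv e) = (label e)^-1 & einv (einv e) = e].

Definition deterministic (T : automaton G) : Prop :=
  forall e e' : edge T, label e = label e' ->
    src e = src e' \/ tgt e = tgt e' -> e = e'.

Fixpoint is_path (T : automaton G) (p : vertex T) (w : seq (edge T))
    (q : vertex T) : Prop :=
  if w is e :: w' then src e = p /\ is_path (tgt e) w' q else p = q.

Definition reduced_path (T : automaton G) (w : seq (edge T)) : Prop :=
  forall u v e, w <> u ++ [:: e, einv e & v].

Definition connected_automaton (T : automaton G) : Prop :=
  forall p q : vertex T, exists w, is_path p w q.

Definition trim (T : automaton G) : Prop :=
  (forall p : vertex T, exists u v,
     [/\ is_path (base T) u p, is_path p v (base T) & reduced_path (u ++ v)]) /\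
  (forall e : edge T, exists u v,
     is_path (base T) (u ++ e :: v) (base T) /\ reduced_path (u ++ e :: v)).

Definition Stallings_automaton (T : automaton G) : Prop :=
  [/\ involutive_automaton T, connected_automaton T, deterministic T & trim T].

Definition recognized (T : automaton G) : set G :=
  [set g | exists w, [/\ is_path (base T) w (base T), reduced_path w
                       & \prod_(e <- w) label e = g]].

(* T is Gamma_C(H), which is determined up to isomorphism *)
Definition is_Stallings_of (H : set G) (T : automaton G) : Prop :=
  Stallings_automaton T /\ recognized T = H.

Record automaton_hom (T U : automaton G) := AutomatonHom {
  vmap : vertex T -> vertex U;
  emap : edge T -> edge U;
  hom_src : forall e, src (emap e) = vmap (src e);
  hom_tgt : forall e, tgt (emap e) = vmap (tgt e);
  hom_label : forall e, label (emap e) = label e;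
  hom_base : vmap (base T) = base U }.

Definition onto_hom (T U : automaton G) (f : automaton_hom T U) : Prop :=
  (forall q, exists p, vmap f p = q) /\ (forall e', exists e, emap f e = e').

(* Gamma_C(H), Gamma_C(K) are unique up to isomorphism and the homomorphism
   between them is unique, so it does not matter which ones are exhibited. *)
Definition theta_onto (H K : set G) : Prop :=
  exists (T U : automaton G) (f : automaton_hom T U),
    [/\ is_Stallings_of H T, is_Stallings_of K U & onto_hom f].

End Automata.

Section Extensions.
Variable F : groupType.
Implicit Types A H K L : set F.

Definition onto_ext H K : Prop :=
  extension H K /\
  forall A', is_basis A' [set: F] -> theta_onto A' H K.

(* F is the free group on A.  An overgroup F_B of F with B containing A is given
   by a group FB with basis B and an embedding j : F -> FB mapping A into B. *)
Definition fully_onto_ext A H K : Prop :=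
  extension H K /\
  forall (FB : groupType) (B : set FB) (j : {multiplicative F -> FB}),
    is_basis B [set: FB] -> injective j -> j @` A `<=` B ->
    forall B', is_basis B' [set: FB] -> theta_onto B' (j @` H) (j @` K).

(* [xget] picks the subgroup L with these properties; its first argument is
   only a default value for the case where there is none. *)
Definition alg_closure K H : set F :=
  xget set0 [set L | algebraic H L /\ free_factor L K].

Definition onto_closure K H : set F :=
  generated (\bigcup_(L in [set L | onto_ext H L /\ L `<=` K]) L).

Definition fully_onto_closure A K H : set F :=
  generated (\bigcup_(L in [set L | fully_onto_ext A H L /\ L `<=` K]) L).

End Extensions.

(* Main.v *)
(* A group word traces a path in the Schreier graph of K, and the Stallings
   automaton of K is the part of this graph crossed by the reduced words of K.
   A subgraph through the basepoint has as fundamental group a free factor of K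
   (extend a spanning tree of the subgraph).  Applied to the image of the
   Stallings automaton of H, this shows that algebraic extensions are onto over
   every basis, hence fully onto; applied to a bouquet of loops, it shows that a
   free factor of K contained in M <= K is a free factor of M.
   Onto (resp. fully onto) extensions of H compose and can be joined, so the
   corresponding closure L is an extension of H of the same kind.  As L is
   finitely generated, it is algebraic in some free factor L' of K, one of
   minimal rank among those that contain L; then H <= L' is again onto
   (resp. fully onto), so L' = L. *)

Require Import Defs.
From mathcomp Require Import all_boot all_algebra finmap.
From mathcomp Require Import boolp classical_sets cardinality.

Set Implicit Arguments.
Unset Strict Implicit.
Unset Printing Implicit Defensive.

Local Open Scope classical_set_scope.
Local Open Scope group_scope.

(** * Free reduction of words *)

(** Freeness is defined by words (no nonempty reduced word has value 1), and no universal property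
    is set up; homomorphisms between free groups are replaced by substitutions in words followed by
    free reduction. A set is proved free by exhibiting a substitution that undoes its spelling in a
    known free set; Reidemeister-Schreier rewriting needs one that depends on the point where a
    letter is read. The Schreier graph is not formed as a quotient: its subgraphs are edge relations
    on the Cayley graph, invariant under left multiplication by [K], and their fundamental groups
    are sets of values of words. Automata matter only for the equivalence of [theta_onto] with
    [core_onto]. As [K] may have infinite rank, minimality of rank is taken over finite parts of
    bases of [K], and their sizes are compared by matrices over the field with two elements. For
    full ontoness, algebraicity must survive an embedding into a larger free group: free factors of
    the image pull back. *)

Section Words.
Variable G : groupType.
Implicit Types (C K : set G) (g h k x y z : G) (l : G * bool).
Implicit Types (s t u v w : seq (G * bool)) (S : G -> G * bool -> Prop).

Definition inv_letter l := (l.1, ~~ l.2).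

Definition inv_word w := rev (map inv_letter w).

Definition word_val w := \prod_(l <- w) letter_val l.

Definition word_over C w := forall l, l \in w -> C l.1.

Definition cons_reduce l w :=
  if w is l' :: w' then if l' == inv_letter l then w' else l :: w else [:: l].

Definition reduction w := foldr cons_reduce [::] w.

Lemma inv_letterK : involutive inv_letter.
Proof. by case=> x b; rewrite /inv_letter /= negbK. Qed.

Lemma letter_val_inv l : letter_val (inv_letter l) = (letter_val l)^-1.
Proof. by case: l => x [] //=; rewrite /letter_val /= invgK. Qed.

Lemma word_val_nil : word_val [::] = 1.
Proof. exact: big_nil. Qed.

Lemma word_val_cons l w : word_val (l :: w) = letter_val l * word_val w.
Proof. exact: big_cons. Qed.

Lemma word_val_cat u v : word_val (u ++ v) = word_val u * word_val v.
Proof. exact: big_cat. Qed.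

Lemma word_val1 l : word_val [:: l] = letter_val l.
Proof. exact: big_seq1. Qed.

Lemma inv_word_cons l w : inv_word (l :: w) = inv_word w ++ [:: inv_letter l].
Proof. by rewrite /inv_word /= rev_cons cats1. Qed.

Lemma inv_word_cat u v : inv_word (u ++ v) = inv_word v ++ inv_word u.
Proof. by rewrite /inv_word map_cat rev_cat. Qed.

Lemma inv_wordK : involutive inv_word.
Proof.
move=> w; rewrite /inv_word map_rev revK -map_comp -[RHS]map_id.
by apply: eq_map => l /=; rewrite inv_letterK.
Qed.

Lemma word_val_inv w : word_val (inv_word w) = (word_val w)^-1.
Proof.
elim: w => [|l w IHw]; first by rewrite word_val_nil invg1.
by rewrite inv_word_cons word_val_cat word_val1 IHw letter_val_inv
  word_val_cons invgM.
Qed.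

Lemma reduced_inv_word w : reduced_word (inv_word w) = reduced_word w.
Proof.
rewrite /reduced_word /inv_word rev_sorted sorted_map.
case: w => //= l w; apply: eq_path => a b /=.
by case: a b => x c [y d]; rewrite negbK eq_sym.
Qed.

(** Inverse letters act as mutually inverse permutations of the reduced words (van der Waerden's
    trick); this replaces a confluence argument for free reduction. *)
Lemma cons_reduceK l w :
  reduced_word w -> cons_reduce l (cons_reduce (inv_letter l) w) = w.
Proof.
case: w => [|l' w] /=; first by rewrite eqxx.
rewrite inv_letterK; case: eqP => [->|_] red_w; last by rewrite /= eqxx.
by case: w red_w => //= l2 w /andP[/negPf]; rewrite /inv_letter => ->.
Qed.

Lemma reduced_reduction w : reduced_word (reduction w).
Proof.
elim: w => //= l w; case: (reduction w) => //= l' s red_s.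
case: eqP => [_|/eqP ne]; last by rewrite /= -/(inv_letter l) ne.
exact: path_sorted red_s.
Qed.

Lemma reduction_id w : reduced_word w -> reduction w = w.
Proof.
elim: w => //= l w IHw red_w; rewrite IHw; last exact: path_sorted red_w.
by case: w red_w {IHw} => //= l' w /andP[/negPf]; rewrite /inv_letter => ->.
Qed.

Lemma reduction_catr u v : reduction (u ++ reduction v) = reduction (u ++ v).
Proof. by elim: u => /= [|l u ->] //; rewrite reduction_id ?reduced_reduction. Qed.

Lemma reduction_catl u v : reduction (reduction u ++ v) = reduction (u ++ v).
Proof.
elim: u => //= l u <-; case: (reduction u) => //= l' s.
by case: eqP => //= ->; rewrite cons_reduceK ?reduced_reduction.
Qed.

Lemma reduction_inv_r w : reduction (w ++ inv_word w) = [::].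
Proof.
elim: w => //= l w IHw; rewrite inv_word_cons catA -reduction_catl IHw.
by rewrite /= eqxx.
Qed.

Lemma reduction_inv_l w : reduction (inv_word w ++ w) = [::].
Proof. by rewrite -{2}[w]inv_wordK reduction_inv_r. Qed.

Lemma reduction_inv_word w : reduction (inv_word w) = inv_word (reduction w).
Proof.
rewrite -[RHS]reduction_id; last by rewrite reduced_inv_word reduced_reduction.
(* Uniqueness of inverses: [reduction w ++ inv_word (reduction w)], which reduces to nothing, is
   appended and regrouped so that [inv_word w] cancels against [w]. *)
rewrite -[inv_word w]cats0 -(reduction_inv_r (reduction w)) reduction_catr catA.
by rewrite -reduction_catl reduction_catr reduction_inv_l.
Qed.

Lemma word_val_reduction w : word_val (reduction w) = word_val w.
Proof.
elim: w => //= l w; rewrite word_val_cons => <-.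
case: (reduction w) => [|l' s] /=; first by rewrite word_val_cons.
case: eqP => [->|_]; last by rewrite word_val_cons.
by rewrite word_val_cons letter_val_inv mulVKg.
Qed.

Lemma word_over_cons C l w : word_over C (l :: w) <-> C l.1 /\ word_over C w.
Proof.
split=> [Cw|[Cl Cw] l']; last by rewrite in_cons => /predU1P[->|/Cw].
by split=> [|l' w_l']; apply: Cw; rewrite in_cons ?eqxx ?w_l' ?orbT.
Qed.

Lemma word_over_cat C u v :
  word_over C (u ++ v) <-> word_over C u /\ word_over C v.
Proof.
split=> [Cw|[Cu Cv] l]; last by rewrite mem_cat => /orP[/Cu|/Cv].
by split=> l w_l; apply: Cw; rewrite mem_cat w_l ?orbT.
Qed.

Lemma word_over_inv C w : word_over C w -> word_over C (inv_word w).
Proof. by move=> Cw l; rewrite mem_rev => /mapP[l' /Cw ? ->]. Qed.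

Lemma word_over_sub C C' w : C `<=` C' -> word_over C w -> word_over C' w.
Proof. by move=> sCC' Cw l /Cw/sCC'. Qed.

Lemma generated_sub C : C `<=` generated C.
Proof. by move=> x Cx H [_]; apply. Qed.

Lemma generated_subgroup C : is_subgroup (generated C).
Proof.
split=> [H [[]] //|x y Cx Cy H sgH|x Cx H sgH].
  by case: (sgH) => -[_ HM _] _; exact: HM (Cx _ sgH) (Cy _ sgH).
by case: (sgH) => -[_ _ HV] _; exact: HV (Cx _ sgH).
Qed.

Lemma generated_min C H : is_subgroup H -> C `<=` H -> generated C `<=` H.
Proof. by move=> sgH sCH x; apply. Qed.

Lemma word_val_in H C w :
  is_subgroup H -> C `<=` H -> word_over C w -> H (word_val w).
Proof.
move=> [H1 HM HV] sCH; elim: w => [|l w IHw]; first by rewrite word_val_nil.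
rewrite word_over_cons word_val_cons => -[/sCH Hl /IHw]; apply: HM.
by rewrite /letter_val; case: ifP => _ //; apply: HV.
Qed.

Lemma generatedP C g :
  generated C g <-> exists2 w, word_over C w & word_val w = g.
Proof.
split=> [|[w Cw <-]]; last first.
  exact: word_val_in (generated_subgroup C) (@generated_sub C) Cw.
set W := fun g => exists2 w, word_over C w & word_val w = g.
apply: (@generated_min C W) => [|x Cx]; last first.
  exists [:: (x, true)]; last by rewrite word_val1.
  by move=> l; rewrite inE => /eqP->.
split=> [|_ _ [u Cu <-] [v Cv <-]|_ [w Cw <-]].
- by exists [::]; last exact: word_val_nil.
- by exists (u ++ v); [apply/word_over_cat | rewrite word_val_cat].
- by exists (inv_word w); [apply: word_over_inv | rewrite word_val_inv].
Qed.

(* [traced S g w]: the path labelled [w] that starts at [g] in the Cayley graph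
   only crosses edges allowed by [S]; an edge is given by its source and its
   letter. *)
Fixpoint traced S g w : Prop :=
  if w is l :: w' then S g l /\ traced S (g * letter_val l) w' else True.

Lemma traced_cat S g u v :
  traced S g (u ++ v) <-> traced S g u /\ traced S (g * word_val u) v.
Proof.
elim: u g => [|l u IHu] g /=; first by rewrite word_val_nil mulg1; split=> [|[]].
by rewrite word_val_cons mulgA IHu; split=> [[? []]|[[? ?]]].
Qed.

Lemma tracedP S g w :
  traced S g w <-> forall u l v, w = u ++ l :: v -> S (g * word_val u) l.
Proof.
split=> [Sw u l v def_w | ]; first by move: Sw; rewrite def_w traced_cat => -[_ []].
elim: w g => //= l w IHw g Sw; split.
  by have := Sw [::] l w erefl; rewrite word_val_nil mulg1.
apply: IHw => u l' v def_w; rewrite -mulgA -word_val_cons.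
by apply: (Sw (l :: u) l' v); rewrite def_w.
Qed.

Lemma traced_over C w g : traced (fun _ l => C l.1) g w <-> word_over C w.
Proof.
elim: w g => [|l w IHw] g //=.
by rewrite word_over_cons IHw.
Qed.

Lemma traced_sub S S' g w :
  (forall h l, S h l -> S' h l) -> traced S g w -> traced S' g w.
Proof.
by move=> sSS'; elim: w g => //= l w IHw g [/sSS' ? /IHw].
Qed.

Lemma traced_reduction S g w : traced S g w -> traced S g (reduction w).
Proof.
elim: w g => //= l w IHw g [Sl /IHw].
case: (reduction w) => [|l' s] //=; case: eqP => [->|_] //=.
by rewrite letter_val_inv mulgK => -[].
Qed.

Lemma word_over_reduction C w : word_over C w -> word_over C (reduction w).
Proof. by move=> /(traced_over _ _ 1) /traced_reduction /traced_over. Qed.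

Lemma traced_inv S g w :
    (forall h l, S h l -> S (h * letter_val l) (inv_letter l)) ->
  traced S g w -> traced S (g * word_val w) (inv_word w).
Proof.
move=> Ssym; elim: w g => //= l w IHw g [/Ssym Sl /IHw {}IHw].
rewrite inv_word_cons traced_cat word_val_inv word_val_cons mulgA mulgK.
by split.
Qed.

Lemma traced_mul S K k g w :
    (forall h k l, K k -> S h l -> S (k * h) l) -> K k ->
  traced S g w -> traced S (k * g) w.
Proof.
move=> SK Kk; elim: w g => //= l w IHw g [/SK Sl /IHw]; rewrite mulgA.
by split=> //; apply: Sl.
Qed.

Lemma reduced_generatedP C g : generated C g <->
  exists w, [/\ word_over C w, reduced_word w & word_val w = g].
Proof.
rewrite generatedP; split=> [[w Cw <-]|[w [Cw _ <-]]]; last by exists w.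
exists (reduction w); rewrite reduced_reduction word_val_reduction.
by split=> //; apply: word_over_reduction.
Qed.

Definition spell C x :=
  xget [::] [set w | [/\ word_over C w, reduced_word w & word_val w = x]].

Lemma spellP C x : generated C x ->
  [/\ word_over C (spell C x), reduced_word (spell C x)
    & word_val (spell C x) = x].
Proof. by move/reduced_generatedP => Cx; exact: (xgetPex [::] Cx). Qed.

Lemma free_reduction C w : free_set C -> word_over C w -> word_val w = 1 ->
  reduction w = [::].
Proof.
move=> freeC Cw val_w.
apply: freeC (reduced_reduction w) _; first exact: word_over_reduction.
by rewrite -/(word_val _) word_val_reduction.
Qed.

Lemma free_word_uniq C u v : free_set C -> word_over C u -> word_over C v ->
  reduced_word u -> reduced_word v -> word_val u = word_val v -> u = v.
Proof.
move=> freeC Cu Cv red_u red_v eq_uv.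
have /(free_reduction freeC) uv1 : word_over C (u ++ inv_word v).
  by apply/word_over_cat; split=> //; apply: word_over_inv.
rewrite word_val_cat word_val_inv eq_uv mulgV in uv1.
(* [u] is expanded to [u ++ inv_word v ++ v], whose first two parts reduce to nothing by [uv1]. *)
rewrite -(reduction_id red_u) -(reduction_id red_v) -[u in LHS]cats0.
rewrite -(reduction_inv_l v) reduction_catr catA -reduction_catl.
by rewrite uv1.
Qed.

Lemma free_sub C C' : C `<=` C' -> free_set C' -> free_set C.
Proof. by move=> sCC' freeC' w Cw; apply: freeC' => l /Cw/sCC'. Qed.

End Words.

(** * Substitution in words *)

Section Substitution.
Variable G : groupType.
Implicit Types (C K Z : set G) (g h k x y z : G) (l : G * bool).
Implicit Types (s t u v w : seq (G * bool)).
Implicit Type phi : G -> G * bool -> seq (G * bool).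

(* The word substituted for a letter may depend on the point of the Cayley graph
   at which the letter is read. *)
Fixpoint word_subst phi g w : seq (G * bool) :=
  if w is l :: w' then phi g l ++ word_subst phi (g * letter_val l) w'
  else [::].

(** Reading an edge backwards gives the inverse word. This makes substitution along paths of the
    Cayley graph respect free reduction. *)
Definition compatible_subst phi := forall g l,
  phi (g * letter_val l) (inv_letter l) = inv_word (phi g l).

Definition letter_subst (f : G -> seq (G * bool)) l :=
  if l.2 then f l.1 else inv_word (f l.1).

Lemma word_subst_cat phi g u v :
  word_subst phi g (u ++ v) =
  word_subst phi g u ++ word_subst phi (g * word_val u) v.
Proof.
elim: u g => [|l u IHu] g /=; first by rewrite word_val_nil mulg1.
by rewrite IHu catA word_val_cons mulgA.
Qed.

Lemma word_subst_mul phi K k g w :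
    (forall h k l, K k -> phi (k * h) l = phi h l) -> K k ->
  word_subst phi (k * g) w = word_subst phi g w.
Proof.
by move=> phiK Kk; elim: w g => //= l w IHw g; rewrite phiK // -mulgA IHw.
Qed.

Lemma word_subst_inv phi g w : compatible_subst phi ->
  word_subst phi (g * word_val w) (inv_word w) = inv_word (word_subst phi g w).
Proof.
move=> phiV; elim: w g => //= l w IHw g.
rewrite inv_word_cons word_subst_cat word_val_cons mulgA IHw inv_word_cat.
by rewrite word_val_inv mulgK /= phiV cats0.
Qed.

Lemma word_subst_reduction phi g w : compatible_subst phi ->
  reduction (word_subst phi g (reduction w)) = reduction (word_subst phi g w).
Proof.
move=> phiV; elim: w g => //= l w IHw g.
rewrite -[RHS]reduction_catr -IHw reduction_catr.
case: (reduction w) => [|l' s] //=; case: eqP => [->|_] //=.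
rewrite phiV letter_val_inv mulgK catA -[RHS]reduction_catl.
by rewrite reduction_inv_r.
Qed.

Lemma compatible_letter_subst f : compatible_subst (fun _ => letter_subst f).
Proof. by move=> _ [x []]; rewrite /letter_subst //= inv_wordK. Qed.

Lemma letter_subst_over C Z f l :
    (forall z, Z z -> word_over C (f z)) -> Z l.1 ->
  word_over C (letter_subst f l).
Proof.
by move=> Cf /Cf Cfl; rewrite /letter_subst; case: ifP => // _; exact: word_over_inv.
Qed.

Lemma letter_subst_val Z f l :
    (forall z, Z z -> word_val (f z) = z) -> Z l.1 ->
  word_val (letter_subst f l) = letter_val l.
Proof.
move=> fE Zl; rewrite /letter_subst /letter_val.
by case: ifP => _; rewrite ?word_val_inv fE.
Qed.

Lemma word_subst_letters C Z f g w :
    (forall z, Z z -> word_over C (f z) /\ word_val (f z) = z) -> word_over Z w ->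
  word_over C (word_subst (fun _ => letter_subst f) g w) /\
  word_val (word_subst (fun _ => letter_subst f) g w) = word_val w.
Proof.
move=> fP; elim: w g => [|l w IHw] g; first by [].
rewrite word_over_cons => -[Zl /(IHw (g * letter_val l)) [Cw val_w]] /=.
rewrite word_val_cat word_val_cons val_w; split.
  by apply/word_over_cat; split=> //; apply: (letter_subst_over _ Zl) => z /fP[].
by congr (_ * _); apply: (letter_subst_val _ Zl) => z /fP[].
Qed.

(* A left inverse up to free reduction of the substitution that spells the
   elements of [Z] in the free set [C] detects reduced words over [Z]. *)
Lemma free_criterion C K Z phi :
    free_set C -> is_subgroup K -> Z `<=` K -> compatible_subst phi ->
    (forall g k l, K k -> phi (k * g) l = phi g l) ->
    (forall z, Z z -> exists w, [/\ word_over C w, word_val w = z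
       & reduction (word_subst phi 1 w) = [:: (z, true)]]) ->
  free_set Z.
Proof.
move=> freeC sgK sZK phiV phiK Zw.
pose f z := xget [::] [set w | [/\ word_over C w, word_val w = z
  & reduction (word_subst phi 1 w) = [:: (z, true)]]].
have fP z : Z z -> [/\ word_over C (f z), word_val (f z) = z
  & reduction (word_subst phi 1 (f z)) = [:: (z, true)]].
  by move=> /Zw w_z; exact: (xgetPex [::] w_z).
pose psi := letter_subst f.
pose F := word_subst (fun _ => psi).
have phi_psi l : Z l.1 -> reduction (word_subst phi 1 (psi l)) = [:: l].
  case: l => z [] /= Zz; rewrite /psi /letter_subst /=; have [_ fz fE] := fP z Zz.
    by [].
  (* Invariance under [z] in [K] moves the starting point from [1] to [z], the endpoint of [f z],
     from which the path of [f z] can be read backwards. *)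
  rewrite -(word_subst_mul _ _ phiK (sZK z Zz)) mulg1 -[z in word_subst _ z]fz.
  by rewrite -[word_val _]mul1g word_subst_inv // reduction_inv_word fE.
have fP' z : Z z -> word_over C (f z) /\ word_val (f z) = z by move=> /fP[].
have redF w g : word_over Z w ->
    reduction (word_subst phi 1 (F g w)) = reduction w.
  elim: w g => [|l w IHw] g; first by [].
  rewrite word_over_cons => -[Zl /(IHw (g * letter_val l)) /= <-].
  have val_l : word_val (psi l) = letter_val l.
    by apply: (letter_subst_val _ Zl) => z /fP[].
  rewrite word_subst_cat val_l mul1g -reduction_catl phi_psi //.
  have Kl : K (letter_val l).
    have [_ _ KV] := sgK; rewrite /letter_val.
    by case: ifP => _; [|apply: KV]; apply: sZK.
  by rewrite -[letter_val l]mulg1 (word_subst_mul _ _ phiK Kl).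
move=> w Zw' red_w val_w; have [CFw valFw] := word_subst_letters 1 fP' Zw'.
(* [w] is recovered from its expansion over [C], and this expansion has value 1, so it reduces to
   the empty word. *)
rewrite -(reduction_id red_w) -(redF w 1 Zw') -word_subst_reduction //.
by rewrite (free_reduction freeC CFw) // valFw.
Qed.

End Substitution.

(** * Schreier transversals and free factors *)

Section SchreierTransversals.
Variables (G : groupType) (K : set G).
Hypothesis sgK : is_subgroup K.
Implicit Types (C R : set G) (g h k r x y z : G) (l : G * bool).
Implicit Types (s t u v w : seq (G * bool)) (S : G -> G * bool -> Prop).

Let K1 : K 1. Proof. by case: sgK. Qed.
Let KM g h : K g -> K h -> K (g * h). Proof. by case: sgK => _ + _; apply. Qed.
Let KV g : K g -> K g^-1. Proof. by case: sgK => _ _; apply. Qed.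

(* An edge relation on the Cayley graph that is symmetric and comes from the
   Schreier graph of [K]. *)
Definition schreier_edges S :=
  (forall g l, S g l -> S (g * letter_val l) (inv_letter l)) /\
  (forall g k l, K k -> S g l -> S (k * g) l).

(** The fundamental group, at the basepoint, of the subgraph [S] of the Schreier graph of [K]. *)
Definition traced_part S : set G :=
  [set g | K g /\ exists2 w, traced S 1 w & word_val w = g].

(** Since [R] consists of group elements rather than cosets, the product of a representative by the
    letter must itself be a representative. This is what makes the Schreier generators of tree edges
    trivial. *)
Definition tree_edge S R g l := [/\ S g l, R g & R (g * letter_val l)].

(* [R] contains at most one element of each right coset of [K], and spans a
   subtree, rooted at [1], of the Schreier graph. *)
Definition schreier_set S R :=
  [/\ R 1, forall r r', R r -> R r' -> K (r * r'^-1) -> r = r'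
    & forall r, R r -> exists2 w, traced (tree_edge S R) 1 w & word_val w = r].

Lemma traced_part_subgroup S : schreier_edges S -> is_subgroup (traced_part S).
Proof.
move=> [Ssym SK].
split=> [|x y [Ku [u Su val_u]] [Kv [v Sv val_v]]|x [Kw [w Sw val_w]]];
  last 2 first.
- rewrite -val_u -val_v in Ku Kv *; split; first exact: KM.
  exists (u ++ v); rewrite ?word_val_cat // traced_cat; split=> //.
  by rewrite mul1g -[word_val u]mulg1; exact: traced_mul SK Ku Sv.
- rewrite -val_w in Kw *; split; first exact: KV.
  exists (inv_word w); rewrite ?word_val_inv //.
  rewrite -[1](mulVg (word_val w)); apply: traced_mul SK (KV Kw) _ => /=.
  by rewrite -[word_val w]mul1g; apply: traced_inv.
by split=> //; exists [::]; rewrite ?word_val_nil.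
Qed.

Lemma tree_edge_sub S S' R R' g l :
    (forall h l', S h l' -> S' h l') -> R `<=` R' ->
  tree_edge S R g l -> tree_edge S' R' g l.
Proof. by move=> sS sR [/sS Sl /sR Rg /sR Rgl]. Qed.

Lemma schreier_set1 S : schreier_set S [set 1].
Proof.
split=> // [_ _ -> -> //|_ ->]; by exists [::]; rewrite ?word_val_nil.
Qed.

Lemma schreier_set_sub S S' R : (forall g l, S g l -> S' g l) ->
  schreier_set S R -> schreier_set S' R.
Proof.
move=> sS [R1 Runiq Rtree]; split=> // r /Rtree[w Rw w_r].
by exists w => //; apply: traced_sub Rw => g l; apply: tree_edge_sub.
Qed.

Lemma schreier_set_add S R r l : schreier_set S R -> R r -> S r l ->
    (forall r', R r' -> ~ K (r * letter_val l * r'^-1)) ->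
  schreier_set S (R `|` [set r * letter_val l]).
Proof.
move=> [R1 Runiq Rtree] Rr Sl new; set R' := _ `|` _.
have sRR' : R `<=` R' by left.
split=> [|a b [Ra|->] [Rb|->] // Kab|a [Ra|->]]; first by left.
- exact: Runiq.
- by case: (new a Ra); rewrite -[_ * _]invgK invgM invgK; apply: KV.
- by case: (new b Rb).
- have [w Rw w_a] := Rtree _ Ra; exists w => //.
  by apply: traced_sub Rw => g l'; apply: tree_edge_sub.
have [w Rw w_r] := Rtree _ Rr; exists (w ++ [:: l]).
  rewrite traced_cat mul1g w_r; split.
    by apply: traced_sub Rw => g l'; apply: tree_edge_sub.
  by split=> //; split; [exact: Sl | exact: sRR' | right].
by rewrite word_val_cat w_r word_val1.
Qed.

(** A maximal Schreier set above [R0]: an edge leading from [R] to a coset without representative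
    would allow one more element to be added. *)
Lemma schreier_set_extend S R0 : schreier_set S R0 ->
  exists R, [/\ R0 `<=` R, schreier_set S R &
    forall r l, R r -> S r l -> exists2 r', R r' & K (r * letter_val l * r'^-1)].
Proof.
move=> schR0; have [R0_1 R0uniq R0tree] := schR0.
(* [R0] is built into the property so that the empty chain, whose union is empty, satisfies it
   too. *)
pose P R := schreier_set S (R0 `|` R).
have [F sFP Fchain|A [PA maxA]] := @Zorn_bigcup G P.
  set U := \bigcup_(X in F) X.
  have inX a b : (R0 `|` U) a -> (R0 `|` U) b ->
      (R0 a /\ R0 b) \/ exists2 X, F X & (R0 `|` X) a /\ (R0 `|` X) b.
    move=> [R0a|[X FX Xa]] [R0b|[Y FY Yb]]; first by left.
    - by right; exists Y => //; split; [left | right].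
    - by right; exists X => //; split; [right | left].
    have [sXY|sYX] := Fchain X Y FX FY; right.
      by exists Y => //; split; right=> //; apply: sXY.
    by exists X => //; split; right=> //; apply: sYX.
  split=> [|a b Ua Ub Kab|a Ua]; first by left.
    have [[]|[X FX [Xa Xb]]] := inX a b Ua Ub; first by move=> *; apply: R0uniq.
    by have [_ + _] := sFP X FX; apply.
  have [[R0a _]|[X FX [Xa _]]] := inX a a Ua Ua.
    have [w R0w w_a] := R0tree _ R0a; exists w => //.
    by apply: traced_sub R0w => g l; apply: tree_edge_sub => // x; left.
  have [_ _ /(_ _ Xa)[w Xw w_a]] := sFP X FX; exists w => //.
  apply: traced_sub Xw => g l; apply: tree_edge_sub => // x [R0x|Xx]; first by left.
  by right; exists X.
exists (R0 `|` A); split=> [x R0x|//|r l Rr Sl]; first by left.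
apply: contrapT => /forall2NP new.
have new' r' : (R0 `|` A) r' -> ~ K (r * letter_val l * r'^-1).
  by move=> Rr'; case: (new r').
case: (maxA (A `|` [set r * letter_val l])); last first.
  by rewrite /P setUA; apply: schreier_set_add.
split=> [x Ax|sub]; first by left.
by apply: (new' (r * letter_val l)); [right; apply: sub; right | rewrite mulgV].
Qed.

Definition reached S g := exists2 w, traced S 1 w & word_val w = g.

Lemma reached_step S g l : reached S g -> S g l -> reached S (g * letter_val l).
Proof.
move=> [w Sw <-] Sl; exists (w ++ [:: l]).
  by rewrite traced_cat mul1g; split=> //; split.
by rewrite word_val_cat word_val1.
Qed.

Lemma schreier_set_cover S R : schreier_edges S -> schreier_set S R ->
    (forall r l, R r -> S r l ->
       exists2 r', R r' & K (r * letter_val l * r'^-1)) ->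
  forall g, reached S g -> exists2 r, R r & K (g * r^-1).
Proof.
move=> [_ SK] [R1 _ _] step g [w Sw <-].
have cover h : (exists2 r, R r & K (h * r^-1)) -> traced S h w ->
    exists2 r, R r & K (h * word_val w * r^-1).
  elim: w h {Sw} => [|l w IHw] h [r Rr Khr] /=.
    by rewrite word_val_nil mulg1; exists r.
  move=> [Sl Sw]; rewrite word_val_cons mulgA; apply: IHw Sw.
  (* Left translation by an element of [K] carries the edge at [h] to the representative [r] of its
     coset. *)
  have [|r' Rr' Kr'] := step r l Rr.
    by have := SK _ _ _ (KV Khr) Sl; rewrite invgM invgK mulgVK.
  by exists r' => //; have := KM Khr Kr'; rewrite !mulgA mulgVK.
have := cover 1; rewrite mul1g; apply=> //.
by exists 1; rewrite // mulgV.
Qed.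

Section Transversal.
Variable R : set G.
Hypothesis Runiq : forall r r', R r -> R r' -> K (r * r'^-1) -> r = r'.
Hypothesis R1 : R 1.

Definition coset_rep g := xget 1 [set r | R r /\ K (g * r^-1)].

(** Also true for cosets that miss [R], where both sides are the default [1]; hence [rewrite_word]
    is invariant at every point, as [free_criterion] demands. *)
Lemma coset_repK k g : K k -> coset_rep (k * g) = coset_rep g.
Proof.
move=> Kk; rewrite /coset_rep; congr xget; apply/seteqP; split=> r /= [Rr Kr].
  by split=> //; rewrite -[g](mulKg k) -mulgA; apply: KM => //; apply: KV.
by split=> //; rewrite -mulgA; apply: KM.
Qed.

Lemma coset_repP g : (exists2 r, R r & K (g * r^-1)) ->
  R (coset_rep g) /\ K (g * (coset_rep g)^-1).
Proof.
move=> [r Rr Kr].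
exact: (@xgetI _ 1 [set r | R r /\ K (g * r^-1)] r (conj Rr Kr)).
Qed.

Lemma coset_rep_id r : R r -> coset_rep r = r.
Proof.
move=> Rr; have [|Rt Kt] := coset_repP (g := r); first by exists r; rewrite ?mulgV.
by apply/esym/Runiq.
Qed.

(** The Reidemeister-Schreier generator of an edge: along the tree to its source, across the edge,
    and back along the tree from its target. *)
Definition schreier_gen g l :=
  coset_rep g * letter_val l * (coset_rep (g * letter_val l))^-1.

Lemma schreier_genV g l :
  schreier_gen (g * letter_val l) (inv_letter l) = (schreier_gen g l)^-1.
Proof. by rewrite /schreier_gen letter_val_inv mulgK !invgM invgK mulgA. Qed.

Lemma schreier_genK g k l : K k -> schreier_gen (k * g) l = schreier_gen g l.
Proof. by move=> Kk; rewrite /schreier_gen -(mulgA k) !(coset_repK _ Kk). Qed.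

(** Reidemeister rewriting. Only positively crossed edges name generators, so a negative letter
    gives the generator of the opposite edge, with a negative sign. *)
Definition rewrite_word g l : seq (G * bool) :=
  if schreier_gen g l == 1 then [::]
  else if l.2 then [:: (schreier_gen g l, true)]
  else [:: ((schreier_gen g l)^-1, false)].

Lemma rewrite_wordV : compatible_subst rewrite_word.
Proof.
move=> g l; rewrite /rewrite_word schreier_genV invg_eq1; case: eqP => //= _.
by case: l.2 => //=; rewrite invgK.
Qed.

Lemma rewrite_wordK g k l : K k -> rewrite_word (k * g) l = rewrite_word g l.
Proof. by move=> Kk; rewrite /rewrite_word schreier_genK. Qed.

Lemma rewrite_word_tree S g w : traced (tree_edge S R) g w ->
  word_subst rewrite_word g w = [::].
Proof.
elim: w g => //= l w IHw g [[_ Rg Rgl] /IHw ->].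
by rewrite cats0 /rewrite_word /schreier_gen !coset_rep_id // mulgV eqxx.
Qed.

(** The restriction to positive letters [l.2] keeps a generator and its inverse from both being
    listed, which would contradict [free_set]. *)
Definition schreier_gens S : set G :=
  [set x | x <> 1 /\
     exists g l, [/\ reached S g, S g l, l.2 & x = schreier_gen g l]].

(** [R] and [S] are kept independent so that one transversal can serve both a subgraph and the whole
    graph: cosets reached inside [S] must have representatives joined to [1] by tree paths inside
    [S]. *)
Definition rep_spelled S := forall g, reached S g -> 
  K (g * (coset_rep g)^-1) /\
  exists2 w, traced (tree_edge S R) 1 w & word_val w = coset_rep g.

Lemma rep_spelledP S :
    (forall g, reached S g -> exists r, [/\ R r, K (g * r^-1) &
       exists2 w, traced (tree_edge S R) 1 w & word_val w = r]) ->
  rep_spelled S.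
Proof.
move=> cover g /cover[r [Rr Kr r_w]].
have [|Rg Kg] := coset_repP (g := g); first by exists r.
split=> //; have -> // : coset_rep g = r.
apply: Runiq => //; have := KM (KV Kg) Kr.
by rewrite invgM invgK mulgA mulgVK.
Qed.

Lemma schreier_gen_word S g l :
    schreier_edges S -> rep_spelled S -> reached S g -> S g l ->
  exists u v, [/\ traced (tree_edge S R) 1 u, word_val u = coset_rep g,
    traced (tree_edge S R) 1 v, word_val v = coset_rep (g * letter_val l) &
    [/\ traced S 1 (u ++ l :: inv_word v), K (schreier_gen g l)
      & word_val (u ++ l :: inv_word v) = schreier_gen g l]].
Proof.
move=> [Ssym SK] cov reach_g Sl.
have [Kg [u Tu val_u]] := cov _ reach_g.
have [Kgl [v Tv val_v]] := cov _ (reached_step reach_g Sl).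
have Kgen : K (schreier_gen g l).
  have -> : schreier_gen g l = (g * (coset_rep g)^-1)^-1 *
      (g * letter_val l * (coset_rep (g * letter_val l))^-1).
    by rewrite /schreier_gen invgM invgK !mulgA mulgVK.
  by apply: KM => //; apply: KV.
have sTS h l' : tree_edge S R h l' -> S h l' by case.
exists u, v; split=> //; split=> //; last first.
  by rewrite word_val_cat word_val_cons word_val_inv val_u val_v mulgA.
rewrite traced_cat mul1g val_u; split; first exact: traced_sub Tu.
split; first by have := SK _ _ _ (KV Kg) Sl; rewrite invgM invgK mulgVK.
have -> : coset_rep g * letter_val l = schreier_gen g l * (1 * word_val v).
  by rewrite mul1g val_v mulgVK.
by apply: traced_mul SK Kgen _; apply: traced_inv => //; apply: traced_sub Tv.
Qed.

Lemma schreier_gens_sub S : schreier_edges S -> rep_spelled S ->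
  schreier_gens S `<=` traced_part S.
Proof.
move=> eS cov x [_ [g [l [reach_g Sl _ ->]]]].
have [u [v [_ _ _ _ [Sw Kgen valw]]]] := schreier_gen_word eS cov reach_g Sl.
by split=> //; exists (u ++ l :: inv_word v).
Qed.

Lemma generated_schreier_gens S : schreier_edges S -> rep_spelled S ->
  generated (schreier_gens S) = traced_part S.
Proof.
move=> eS cov; have [Ssym SK] := eS.
have [g1 gM gV] := generated_subgroup (schreier_gens S).
apply/seteqP; split.
  apply: generated_min; first exact: traced_part_subgroup.
  exact: schreier_gens_sub.
move=> x [Kw [w Sw val_w]]; rewrite -{x}val_w in Kw *.
have gen_edge g l : reached S g -> S g l ->
    generated (schreier_gens S) (schreier_gen g l).
  move=> reach_g Sl; have [->|/eqP ne1] := eqVneq (schreier_gen g l) 1; first exact: g1.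
  have [pos|neg] := boolP l.2.
    by apply: generated_sub; split=> //; exists g, l.
  rewrite -[schreier_gen g l]invgK -schreier_genV.
  apply: gV; apply: generated_sub; split.
    by rewrite schreier_genV => /eqP; rewrite invg_eq1 => /eqP.
  exists (g * letter_val l), (inv_letter l); split=> //; last exact: Ssym.
  exact: reached_step.
(* The product of the generators of the successive edges telescopes: inner representatives
   cancel. *)
have telescope g : reached S g -> traced S g w ->
    generated (schreier_gens S)
      (coset_rep g * word_val w * (coset_rep (g * word_val w))^-1).
  elim: w g {Kw Sw} => [|l w IHw] g reach_g /=.
    by rewrite word_val_nil !mulg1 mulgV.
  move=> [Sl Sw]; rewrite word_val_cons mulgA.
  have := IHw _ (reached_step reach_g Sl) Sw.
  move=> /(gM _ _ (gen_edge _ _ reach_g Sl)).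
  by rewrite /schreier_gen !mulgA mulgVK.
have reach1 : reached S 1 by exists [::]; rewrite ?word_val_nil.
have := telescope 1 reach1 Sw.
rewrite mul1g -{2}[word_val w]mulg1 coset_repK // coset_rep_id //.
by rewrite invg1 mulg1 mul1g.
Qed.

(** Rewriting the loop [u ++ l :: inv_word v] erases the tree paths [u] and [v] and leaves the
    single letter of its generator, which is the witness that [free_criterion] asks for. *)
Lemma free_schreier_gens C S : free_set C -> schreier_edges S -> rep_spelled S ->
  (forall g l, S g l -> C l.1) -> free_set (schreier_gens S).
Proof.
move=> freeC eS cov SC.
apply: (free_criterion (phi := rewrite_word) freeC sgK) => [x||g k l|x [ne1]].
- by case/(schreier_gens_sub eS cov).
- exact: rewrite_wordV.
- exact: rewrite_wordK.
move=> [g [l [reach_g Sl pos def_x]]].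
have [u [v [Tu valu Tv valv [Sw Kgen valw]]]] := schreier_gen_word eS cov reach_g Sl.
exists (u ++ l :: inv_word v); split; last 1 first.
- have [Kg _] := cov _ reach_g.
  rewrite word_subst_cat (rewrite_word_tree Tu) mul1g valu /=.
  have -> : coset_rep g * letter_val l = schreier_gen g l * word_val v.
    by rewrite valv mulgVK.
  rewrite (word_subst_mul _ _ rewrite_wordK Kgen) -[word_val v]mul1g word_subst_inv;
    last exact: rewrite_wordV.
  rewrite (rewrite_word_tree Tv) cats0.
  have -> : rewrite_word (coset_rep g) l = rewrite_word g l.
    by rewrite -[LHS](rewrite_wordK _ _ Kg) mulgVK.
  by rewrite /rewrite_word -def_x; case: eqP => // _; rewrite pos.
- by apply/(traced_over _ _ 1); apply: traced_sub Sw => h l'; apply: SC.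
- by rewrite valw.
Qed.

End Transversal.

Lemma schreier_edges_all C : schreier_edges (fun _ l => C l.1).
Proof. by []. Qed.

Lemma traced_part_all C : K `<=` generated C ->
  traced_part (fun _ l => C l.1) = K.
Proof.
move=> sKC; apply/seteqP; split=> [g []//|g Kg]; split=> //.
by have /generatedP[w Cw val_w] := sKC g Kg; exists w => //; apply/traced_over.
Qed.

(* The fundamental group of a subgraph is a free factor of the fundamental group
   of the graph: extend a spanning tree of the subgraph. *)
Lemma traced_part_free_factor C S : free_set C -> K `<=` generated C ->
    schreier_edges S -> (forall g l, S g l -> C l.1) ->
  free_factor (traced_part S) K.
Proof.
move=> freeC sKC eS SC; pose SA (g : G) l := C l.1.
have eSA : schreier_edges SA by exact: schreier_edges_all.
(* [R1] spans the component of the basepoint in the subgraph; [R] extends it to the whole graph, so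
   the generators for [S] are among those for [SA]. *)
have [R1 [_ schR1 step1]] := schreier_set_extend (schreier_set1 S).
have [R [sR1R schR step]] := schreier_set_extend (schreier_set_sub SC schR1).
have [R_1 Runiq Rtree] := schR; have [_ _ R1tree] := schR1.
(* Cosets reached inside [S] keep their representative from [R1], because [R] has at most one per
   coset. *)
have spellS : rep_spelled R S.
  apply: rep_spelledP => // g /(schreier_set_cover eS schR1 step1)[r R1r Kr].
  exists r; split=> //; first exact: sR1R.
  have [w R1w w_r] := R1tree _ R1r; exists w => //.
  by apply: traced_sub R1w => h l; apply: tree_edge_sub.
have spellSA : rep_spelled R SA.
  apply: rep_spelledP => // g /(schreier_set_cover eSA schR step)[r Rr Kr].
  by exists r; split=> //; apply: Rtree.
exists (schreier_gens R S), (schreier_gens R SA); split.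
- split; last exact: generated_schreier_gens.
  exact: free_schreier_gens SC.
- split; last by rewrite generated_schreier_gens // traced_part_all.
  by apply: (free_schreier_gens Runiq freeC eSA).
move=> x [ne1 [g [l [[w Sw w_g] Sl pos def_x]]]]; split=> //.
exists g, l; split=> //; last exact: SC Sl.
by exists w => //; apply: traced_sub Sw.
Qed.

End SchreierTransversals.

(** * Core edges of Schreier graphs *)

Section CoreEdges.
Variable G : groupType.
Implicit Types (C H K L M : set G) (g h k x y z : G) (l : G * bool).
Implicit Types (u v w : seq (G * bool)) (W : set (seq (G * bool))).
Implicit Types (S : G -> G * bool -> Prop).

Lemma subgroup1 H : is_subgroup H -> H 1.
Proof. by case. Qed.

Lemma subgroupM H x y : is_subgroup H -> H x -> H y -> H (x * y).
Proof. by case=> _ + _; apply. Qed.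

Lemma subgroupV H x : is_subgroup H -> H x -> H x^-1.
Proof. by case=> _ _; apply. Qed.

(* The edge of the Schreier graph of [K] that starts at [K g] and carries the
   letter [l] is crossed by the path from the basepoint that spells some word
   in [W]. *)
Definition word_edge K W g l :=
  exists u v, W (u ++ l :: v) /\ K (g * (word_val u)^-1).

Definition reduced_words C H : set (seq (G * bool)) :=
  [set w | [/\ word_over C w, reduced_word w & H (word_val w)]].

(* The edges of the image of the Stallings automaton of [H] in that of [K]. *)
Definition core_edge C H K := word_edge K (reduced_words C H).

Definition core_onto C H K :=
  forall g l, core_edge C K K g l -> core_edge C H K g l.

Lemma word_edge_schreier K W : is_subgroup K ->
    (forall w, W w -> W (inv_word w) /\ K (word_val w)) ->
  schreier_edges K (word_edge K W).
Proof.
move=> sgK WV.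
split=> [g l [u [v [Ww Kg]]]|g k l Kk [u [v [Ww Kg]]]]; last first.
  by exists u, v; split=> //; rewrite -mulgA; apply: subgroupM.
have [WVw Kw] := WV _ Ww; exists (inv_word v), (inv_word u); split.
  by move: WVw; rewrite inv_word_cat inv_word_cons -catA.
have := subgroupM sgK Kg Kw.
by rewrite word_val_cat word_val_cons word_val_inv invgK !mulgA mulgVK.
Qed.

Lemma word_edge_traced K W w : is_subgroup K -> W w ->
  traced (word_edge K W) 1 w.
Proof.
move=> sgK Ww; apply/tracedP => u l v def_w; exists u, v.
by rewrite -def_w mul1g mulgV; split=> //; apply: subgroup1.
Qed.

Lemma core_edge_schreier C H K : is_subgroup H -> is_subgroup K -> H `<=` K ->
  schreier_edges K (core_edge C H K).
Proof.
move=> sgH sgK sHK; apply: word_edge_schreier => // w [Cw red_w Hw].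
split; last exact: sHK.
split; [exact: word_over_inv | by rewrite reduced_inv_word |].
by rewrite word_val_inv; apply: subgroupV.
Qed.

Lemma core_edge_over C H K g l : core_edge C H K g l -> C l.1.
Proof. by move=> [u [v [[/word_over_cat[_ /word_over_cons[]]]]]]. Qed.

Lemma core_edge_sub C H H' K g l :
  H `<=` H' -> core_edge C H K g l -> core_edge C H' K g l.
Proof.
move=> sHH' [u [v [[Cw red_w Hw] Kg]]]; exists u, v; split=> //; split=> //.
exact: sHH'.
Qed.

Lemma traced_core_edge C H K : is_subgroup K -> H `<=` K ->
  H `<=` generated C -> H `<=` traced_part K (core_edge C H K).
Proof.
move=> sgK sHK sHC h Hh; split; first exact: sHK.
have /reduced_generatedP[w [Cw red_w val_w]] := sHC h Hh.
by exists w => //; apply: word_edge_traced => //; split; rewrite ?val_w.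
Qed.

(** The core of [L] is the smallest subgraph whose fundamental group contains [L]: a traced word
    stays traced when reduced, and its reduced form is the only reduced word with that value. *)
Lemma core_edge_min C L K S g l : free_set C -> schreier_edges K S ->
    (forall h l', S h l' -> C l'.1) -> L `<=` traced_part K S ->
  core_edge C L K g l -> S g l.
Proof.
move=> freeC [_ SK] SC sLS [u [v [[Cw red_w Lw] Kg]]].
have [_ [w Sw val_w]] := sLS _ Lw.
have Cw' : word_over C w by apply/(traced_over _ _ 1); apply: traced_sub Sw.
have /tracedP/(_ u l v) := traced_reduction Sw.
rewrite mul1g -[g](mulgVK (word_val u)) => Su; apply: SK Kg (Su _).
apply: (free_word_uniq freeC) => //; first exact: word_over_reduction.
  exact: reduced_reduction.
by rewrite word_val_reduction.
Qed.

Lemma core_edge_trans C H L K g l : is_subgroup L -> is_subgroup K ->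
    L `<=` K -> core_onto C H L ->
  core_edge C L K g l -> core_edge C H K g l.
Proof.
move=> sgL sgK sLK onto [u [v [Lw Kg]]].
have [|u' [v' [Hw' Lu]]] := onto (word_val u) l.
  by exists u, v; split; rewrite // mulgV; apply: subgroup1.
exists u', v'; split=> //; have := subgroupM sgK Kg (sLK _ Lu).
by rewrite mulgA mulgVK.
Qed.

Lemma core_onto_trans C H L K : is_subgroup L -> is_subgroup K -> L `<=` K ->
  core_onto C H L -> core_onto C L K -> core_onto C H K.
Proof.
by move=> sgL sgK sLK HL LK g l /LK; apply: core_edge_trans.
Qed.

Lemma core_onto_subl C H L K : H `<=` L -> core_onto C H K -> core_onto C L K.
Proof. by move=> sHL HK g l /HK; apply: core_edge_sub. Qed.

(** By minimality of the core of [K], it is enough that each [L] in [D] be traced in the image of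
    the core of [H], and there the ontoness of [H] in [L] applies. *)
Lemma core_onto_join C H (D : set (set G)) :
    let K := generated (\bigcup_(L in D) L) in
    free_set C -> is_subgroup H -> D H -> K `<=` generated C ->
    (forall L, D L -> [/\ is_subgroup L, H `<=` L & core_onto C H L]) ->
  core_onto C H K.
Proof.
move=> K freeC sgH DH sKC DP g l.
have sgK : is_subgroup K by exact: generated_subgroup.
have sDK L : D L -> L `<=` K.
  by move=> DL x Lx; apply: generated_sub; exists L.
have eHK : schreier_edges K (core_edge C H K).
  by apply: core_edge_schreier => //; apply: sDK.
apply: core_edge_min => //; first by move=> h l'; apply: core_edge_over.
apply: generated_min => [|x [L DL Lx]]; first exact: traced_part_subgroup.
have [sgL sHL onto] := DP L DL.
have sLC := subset_trans (sDK L DL) sKC.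
have [Kx [w Lw val_w]] := traced_core_edge sgK (sDK L DL) sLC Lx.
split=> //; exists w => //; apply: traced_sub Lw => h l'.
by apply: core_edge_trans => //; apply: sDK.
Qed.

Lemma algebraic_core_onto C H K : free_set C -> K `<=` generated C ->
  algebraic H K -> core_onto C H K.
Proof.
move=> freeC sKC [[sgH sgK sHK] minK] g l.
have eHK := core_edge_schreier C sgH sgK sHK.
have CE h l' : core_edge C H K h l' -> C l'.1 by exact: core_edge_over.
apply: core_edge_min => //; rewrite [X in _ `<=` X]minK //.
  exact: (traced_part_free_factor sgK freeC).
by apply: traced_core_edge => //; apply: subset_trans sKC.
Qed.

Lemma free_factor_sub L K : free_factor L K ->
  [/\ is_subgroup L, is_subgroup K & L `<=` K].
Proof.
move=> [X [Y [[_ <-] [_ <-] sXY]]].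
split; [exact: generated_subgroup..|].
apply: generated_min; first exact: generated_subgroup.
exact: subset_trans sXY (@generated_sub _ Y).
Qed.

Lemma free_factor_mid L M K : is_subgroup M -> L `<=` M -> M `<=` K ->
  free_factor L K -> free_factor L M.
Proof.
move=> sgM sLM sMK [X [Y [[freeX genX] [freeY genY] sXY]]].
(* The bouquet: at the base vertex of the Schreier graph of [M] over the basis [Y] of [K], the loops
   labelled by [X]. *)
pose S g (l : G * bool) := M g /\ X l.1.
have sXM : X `<=` M.
  by apply: subset_trans sLM; rewrite -genX; apply: generated_sub.
have MX l : X l.1 -> M (letter_val l).
  by rewrite /letter_val => /sXM Ml; case: ifP => // _; apply: subgroupV.
have eS : schreier_edges M S.
  split=> [g l [Mg Xl]|g k l Mk [Mg Xl]]; split=> //; apply: subgroupM => //.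
  exact: MX.
suff <- : traced_part M S = L.
  apply: traced_part_free_factor freeY _ eS _ => //; first by rewrite genY.
  by move=> g l [_ /sXY].
apply/seteqP; split=> [g [_ [w Sw <-]]|g Lg].
  rewrite -genX; apply/generatedP; exists w => //.
  by apply/(traced_over _ _ 1); apply: traced_sub Sw => h l [].
split; first exact: sLM.
move: Lg; rewrite -genX => /generatedP[w Xw <-]; exists w => //.
elim: w {g} 1 (subgroup1 sgM) Xw => //= l w IHw g Mg /word_over_cons[Xl Xw].
by split=> //; apply: IHw => //; apply: subgroupM => //; apply: MX.
Qed.

(** The Nielsen-Schreier theorem, obtained by taking the whole Schreier graph as the subgraph. *)
Lemma subgroup_basis C K : free_set C -> is_subgroup K -> K `<=` generated C ->
  exists Y, is_basis Y K.
Proof.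
move=> freeC sgK sKC.
have [|_ [Y [_ basisY _]]] :=
  traced_part_free_factor sgK freeC sKC (schreier_edges_all K C); first by [].
by exists Y.
Qed.

(** Words spelling finitely many generators of [H] cross finitely many edges of the Schreier graph
    of [K]. By ontoness these edges cover the core of [K], so their Schreier generators generate
    [K]. *)
Lemma core_onto_finitely_generated C H K : free_set C -> is_subgroup H ->
    is_subgroup K -> H `<=` K -> K `<=` generated C ->
  finitely_generated H -> core_onto C H K -> finitely_generated K.
Proof.
move=> freeC sgH sgK sHK sKC [_ /finite_seqP[s ->] genH] onto.
pose f := spell C.
have fP x : x \in s ->
    [/\ word_over C (f x), reduced_word (f x) & word_val (f x) = x].
  move=> s_x; apply: spellP; apply: (sKC); apply: sHK.
  by rewrite -genH; apply: generated_sub.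
(* Inverse words are added so that the edge relation [S] is symmetric. *)
pose ws := map f s ++ map (@inv_word G \o f) s.
pose S := word_edge K [set w | w \in ws].
have wsP w : w \in ws ->
    [/\ word_over C w, inv_word w \in ws & K (word_val w)].
  have sK x : x \in s -> K x.
    by move=> s_x; apply: sHK; rewrite -genH; apply: generated_sub.
  rewrite !mem_cat => /orP[] /mapP[x s_x ->] /=; have [Cfx _ fx] := fP x s_x.
    split=> //; last by rewrite fx; apply: sK.
    by rewrite -[inv_word _]/((@inv_word G \o f) x) map_f ?orbT.
  rewrite inv_wordK map_f // word_val_inv fx.
  by split=> //; [apply: word_over_inv | apply: subgroupV => //; apply: sK].
have eS : schreier_edges K S by apply: word_edge_schreier => // w /wsP[].
have SC g l : S g l -> C l.1.
  by move=> [u [v [/wsP[/word_over_cat[_ /word_over_cons[]]]]]].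
have sHS : H `<=` traced_part K S.
  rewrite -genH; apply: generated_min => [|x s_x].
    exact: traced_part_subgroup.
  have [_ _ fx] := fP x s_x; split.
    by apply: sHK; rewrite -genH; apply: generated_sub.
  exists (f x) => //; apply: word_edge_traced => //=.
  by rewrite mem_cat map_f.
(* Core edges of [K] are core edges of [H], and those lie in [S] by minimality, as [S] already
   traces generators of [H]. *)
have defK : traced_part K S = K.
  apply/seteqP; split=> [g []//|g Kg].
  have [_ [w Kw val_w]] := traced_core_edge sgK (@subset_refl _ K) sKC Kg.
  split=> //; exists w => //; apply: traced_sub Kw => h l /onto.
  exact: core_edge_min.
have [R [_ schR step]] := schreier_set_extend sgK (schreier_set1 K S).
have [R1 Runiq Rtree] := schR.
have spell : rep_spelled K R S.
  apply: rep_spelledP => // g /(schreier_set_cover sgK eS schR step)[r Rr Kr].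
  by exists r; split=> //; apply: Rtree.
exists (schreier_gens K R S); last by rewrite generated_schreier_gens.
(* One candidate per word and position, evaluated at the prefix: a Schreier generator depends only
   on the coset of its starting point. The default letter is never read, since [i < size w]. *)
pose vals := [seq schreier_gen K R (word_val (take i w)) (nth (1, true) w i)
             | w <- ws, i <- iota 0 (size w)].
apply: (@sub_finite_set _ _ [set x | x \in vals]); last exact: finite_seq.
move=> _ [_ [g [l [_ [u [v [ws_w Ku]]] _ ->]]]] /=.
apply/allpairsPdep; exists (u ++ l :: v), (size u).
split=> //; first by rewrite mem_iota size_cat /= addnS ltnS leq_addr.
rewrite take_size_cat // nth_cat ltnn subnn /=.
rewrite -[g](mulgVK (word_val u)).
exact: (schreier_genK sgK).
Qed.

End CoreEdges.

(** * Ranks and minimal free factors *)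

Section FreeFactors.
Variable G : groupType.
Implicit Types (C H K L X Y Z : set G) (x y z : G) (l : G * bool).
Implicit Types (s : seq G) (u v w : seq (G * bool)).

Import GRing.Theory.

Lemma basis_replace L K X Y Y' : is_basis X L -> is_basis Y K -> X `<=` Y ->
  is_basis Y' L -> is_basis (Y' `|` (Y `\` X)) K.
Proof.
move=> [freeX genX] [freeY genY] sXY [freeY' genY'].
have sgL : is_subgroup L by rewrite -genX; apply: generated_subgroup.
set Z := _ `|` _; split; last first.
  apply/seteqP; split.
    apply: generated_min => [|x]; first by rewrite -genY; apply: generated_subgroup.
    move=> [Y'x|[Yx _]]; rewrite -genY; last exact: generated_sub.
    have : L x by rewrite -genY'; apply: generated_sub.
    rewrite -genX; apply: generated_min => [|z Xz]; first exact: generated_subgroup.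
    by apply: generated_sub; apply: sXY.
  have sZ := generated_subgroup Z.
  rewrite -genY; apply: generated_min => // y Yy.
  have [Xy|nXy] := pselect (X y); last by apply: generated_sub; right.
  have : L y by rewrite -genX; apply: generated_sub.
  rewrite -genY'; apply: generated_min => // z Y'z.
  by apply: generated_sub; left.
(* The change of letters from [Y] to the new basis: [X] is respelled over [Y'], the rest of [Y] is
   kept. An element of [Y'] spelled over [X] is thus turned into a word over [Y'] with the same
   value, which reduces to one letter. *)
pose f x := if `[< X x >] then spell Y' x else [:: (x, true)].
have fX x : X x -> f x = spell Y' x by rewrite /f; case: asboolP.
have sgT : is_subgroup [set: G] by [].
apply: (free_criterion freeY sgT _ (compatible_letter_subst f)) => //.
have single x B : B x -> word_over B [:: (x, true)].
  by move=> Bx; apply/word_over_cons.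
move=> z Zz; have [Y'z|nY'z] := pselect (Y' z); last first.
  have [//|[Yz nXz]] := Zz; exists [:: (z, true)].
  split; rewrite ?word_val1 //; first exact: single.
  by rewrite /letter_subst /= /f; case: asboolP.
have Lz : L z by rewrite -genY'; apply: generated_sub.
have [|Xw red_w val_w] := @spellP _ X z; first by rewrite genX.
exists (spell X z); split=> //; first exact: word_over_sub sXY Xw.
have [|Y'w' val_w'] := word_subst_letters 1 _ Xw (C := Y') (f := f).
  move=> x Xx; rewrite fX //; have [|? _ ?] := @spellP _ Y' x; last by [].
  by rewrite genY' -genX; apply: generated_sub.
apply: (free_word_uniq freeY') => //; first exact: word_over_reduction.
- exact: single.
- exact: reduced_reduction.
- by rewrite word_val_reduction val_w' val_w word_val1.
Qed.

(** The exponent sum of [y] modulo 2: signs disappear, so plain counting is invariant under free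
    reduction, and the values lie in a field. *)
Definition exponent y w : 'F_2 := ((count (fun l => l.1 == y) w)%:R)%R.

Lemma exponent_cons y l w :
  exponent y (l :: w) = ((l.1 == y)%:R + exponent y w)%R.
Proof. by rewrite /exponent /= natrD. Qed.

Lemma exponent_cat y u v : exponent y (u ++ v) = (exponent y u + exponent y v)%R.
Proof. by rewrite /exponent count_cat natrD. Qed.

Lemma exponent_inv y w : exponent y (inv_word w) = exponent y w.
Proof. by rewrite /exponent /inv_word count_rev count_map. Qed.

Lemma exponent_reduction y w : exponent y (reduction w) = exponent y w.
Proof.
elim: w => //= l w; rewrite exponent_cons => <-.
case: (reduction w) => [|l' s] /=; first by rewrite exponent_cons.
case: eqP => [->|_]; last by rewrite exponent_cons.
rewrite exponent_cons addrA -natrD addnn -mul2n natrM.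
by rewrite [X in (X * _)%R](_ : _ = 0)%R ?mul0r ?add0r //; apply/val_inj.
Qed.

Lemma exponent_uniq Y y u v : free_set Y -> word_over Y u -> word_over Y v ->
  word_val u = word_val v -> exponent y u = exponent y v.
Proof.
move=> freeY Yu Yv eq_uv; rewrite -exponent_reduction -[RHS]exponent_reduction.
congr exponent; apply: (free_word_uniq freeY);
  by rewrite ?reduced_reduction ?word_val_reduction //; apply: word_over_reduction.
Qed.

(** Substitution acts linearly on exponents; this is the matrix product formula behind
    [basis_size]. *)
Lemma exponent_subst f y s w g : uniq s -> word_over [set` s] w ->
  exponent y (word_subst (fun _ => letter_subst f) g w) =
  (\sum_(x <- s) exponent x w * exponent y (f x))%R.
Proof.
move=> uniq_s; elim: w g => [|l w IHw] g /=.
  by move=> _; rewrite big1 // => x _; rewrite mul0r.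
move=> /word_over_cons[/= s_l sw]; rewrite exponent_cat IHw //.
under [RHS]eq_bigr do rewrite exponent_cons mulrDl.
rewrite big_split /= [X in _ = (X + _)%R](bigD1_seq l.1) //= eqxx mul1r.
rewrite [X in _ = (_ + X + _)%R]big1 ?addr0 => [|x].
  by congr (_ + _)%R; rewrite /letter_subst; case: ifP; rewrite ?exponent_inv.
by rewrite eq_sym => /negPf->; rewrite mul0r.
Qed.

(* Modulo 2, the exponents of the elements of one basis in the other one and
   conversely form matrices whose product is the identity. *)
Lemma basis_size L Y s s' : uniq s -> is_basis [set` s] L -> is_basis Y L ->
  uniq s' -> [set` s'] `<=` Y -> size s' <= size s.
Proof.
move=> uniq_s [_ gens] [freeY genY] uniq_s' ss'Y.
pose M : 'M['F_2]_(size s', size s) :=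
  (\matrix_(i, j) exponent (nth 1%g s j) (spell [set` s] (nth 1%g s' i)))%R.
pose N : 'M['F_2]_(size s, size s') :=
  (\matrix_(j, k) exponent (nth 1%g s' k) (spell Y (nth 1%g s j)))%R.
suff MN1 : (M *m N = 1%:M)%R.
  by have := mulmx_max_rank M N; rewrite MN1 mxrank1.
apply/matrixP => i k; rewrite !mxE.
have Ys' (j : 'I_(size s')) : Y (nth 1 s' j) by apply: ss'Y; apply: mem_nth.
have [|sw _ val_w] := @spellP _ [set` s] (nth 1 s' i).
  by rewrite gens -genY; apply: generated_sub.
have [|Yw' val_w'] := word_subst_letters 1 _ sw (C := Y) (f := spell Y).
  move=> x s_x; have [|? _ ?] := @spellP _ Y x; last by [].
  by rewrite genY -gens; apply: generated_sub.
under eq_bigr do rewrite !mxE.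
pose term x := (exponent x (spell [set` s] (nth 1%g s' i)) *
  exponent (nth 1%g s' k) (spell Y x))%R.
rewrite -(big_mkord xpredT (fun j => term (nth 1%g s j))).
rewrite -(big_nth 1%g xpredT term) /term.
(* The sum is an exponent of the word that spells the [i]-th element of [s'] over [s] and then over
   [Y]. Its value is that element, so its exponents are those of a single letter. *)
rewrite -(exponent_subst _ _ 1%g) //.
rewrite (exponent_uniq _ (v := [:: (nth 1%g s' i, true)]) freeY) //.
- by rewrite /exponent /= addn0 nth_uniq.
- by apply/word_over_cons; split; first exact: Ys'.
- by rewrite val_w' val_w word_val1.
Qed.

(* A free factor of minimal rank among those containing [H] works. *)
Lemma algebraic_free_factor C H K : free_set C -> extension H K ->
    K `<=` generated C -> finitely_generated H ->
  exists L, algebraic H L /\ free_factor L K.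
Proof.
move=> freeC [sgH sgK sHK] sKC [_ /finite_seqP[gens ->] genH].
have [Y [freeY genY]] := subgroup_basis freeC sgK sKC.
(* [n] is the rank of a free factor of [K] containing [H]; the ambient basis [Y'] may vary with it
   and may be infinite. *)
pose P n := exists s Y', [/\ uniq s, size s = n, is_basis Y' K, [set` s] `<=` Y'
  & H `<=` generated [set` s]].
have [n Pn] : exists n, P n.
  have Yw x : x \in gens -> word_over Y (spell Y x) /\ word_val (spell Y x) = x.
    move=> gens_x; have [|? _ ?] := @spellP _ Y x; last by [].
    by rewrite genY; apply: sHK; rewrite -genH; apply: generated_sub.
  (* Finitely many elements of [Y] suffice to spell the generators of [H]. *)
  pose s := undup [seq l.1 | x <- gens, l <- spell Y x].
  exists (size s), s, Y; split; rewrite ?undup_uniq //.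
    move=> y /=; rewrite mem_undup => /allpairsPdep[x [l [gens_x w_l ->]]].
    by have [/(_ _ w_l)] := Yw x gens_x.
  rewrite -genH; apply: generated_min => [|x gens_x]; first exact: generated_subgroup.
  apply/generatedP; exists (spell Y x); last by have [] := Yw x gens_x.
  move=> l w_l /=; rewrite mem_undup; apply/allpairsPdep.
  by exists x, l.
have [|m /asboolP Pm min_m] := @ex_minnP (fun n => `[< P n >]).
  by exists n; apply/asboolP.
have [s [Y1 [uniq_s size_s basisY1 ssY1 sHs]]] := Pm.
have [freeY1 genY1] := basisY1.
set L := generated [set` s] in sHs.
have basis_s : is_basis [set` s] L by split=> //; apply: free_sub freeY1.
exists L; split; last by exists [set` s], Y1.
split; first by split=> //; apply: generated_subgroup.
move=> L' [X' [Y' [basisX' basisY' sXY']]] sHL'.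
have [<- <-] : generated X' = L' /\ generated Y' = L by case: basisX' basisY' => _ + [].
congr generated; apply/seteqP; split=> // y Y'y; apply: contrapT => nX'y.
(* The strict inequality comes from [y], which lies in [Y'] but not in [X'] and can be added to
   [t]. *)
have small t : uniq t -> [set` t] `<=` X' -> size t < m.
  move=> uniq_t tX'; rewrite -size_s.
  apply: (basis_size (s' := y :: t) uniq_s basis_s basisY') => /=.
    by rewrite uniq_t andbT; apply/negP => /tX'.
  by move=> x /=; rewrite inE => /predU1P[->|/tX'/sXY'].
have /finite_seqP[t def_X'] : finite_set X'.
  apply: contrapT => /(infinite_set_fset m)[B sBX' mB].
  have := small _ (fset_uniq B) sBX'; rewrite ltnNge.
  by have -> : size (B : seq G) = #|` B|%fset by []; rewrite mB.
(* [X'] has fewer than [m] elements, generates a subgroup containing [H], and lies in the basis of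
   [K] obtained by exchanging [s] for [Y'] in [Y1]: this contradicts the minimality of [m]. *)
have := small (undup t) (undup_uniq t); rewrite ltnNge min_m.
  by move=> /(_ _)/negP; apply=> //; rewrite def_X' => x /=; rewrite mem_undup.
apply/asboolP; exists (undup t), (Y' `|` (Y1 `\` [set` s])).
have def_t : [set` undup t] = X'.
  by rewrite def_X'; apply/seteqP; split=> x /=; rewrite mem_undup.
split; rewrite ?undup_uniq // ?def_t.
- exact: basis_replace basis_s _ _ basisY'.
- by move=> x /sXY'; left.
- by case: basisX' => _ ->.
Qed.

End FreeFactors.

(** * Stallings automata *)

Section AutomataPaths.
Variables (G : groupType) (C : set G).
Hypothesis freeC : free_set C.
Implicit Types (T U : automaton G) (g x y : G) (l : G * bool).

Definition path_label T (w : seq (edge T)) := \prod_(e <- w) label e.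

(** Labels are group elements, so the formal sign is recovered by testing membership in [C]; in an
    involutive automaton a label outside [C] has its inverse in [C]. *)
Definition edge_letter T (e : edge T) : G * bool :=
  if `[< C (label e) >] then (label e, true) else ((label e)^-1, false).

Definition inv_path T (w : seq (edge T)) := rev (map (@einv G T) w).

Lemma path_label_cat T (u v : seq (edge T)) :
  path_label (u ++ v) = path_label u * path_label v.
Proof. exact: big_cat. Qed.

Lemma path_label_cons T (e : edge T) w :
  path_label (e :: w) = label e * path_label w.
Proof. exact: big_cons. Qed.

Lemma is_path_cat T (p q : vertex T) u v :
  is_path p (u ++ v) q <-> exists2 r, is_path p u r & is_path r v q.
Proof.
elim: u p => [|e u IHu] p /=; first by split=> [|[_ <-]] //; exists p.
rewrite IHu; split=> [[? [r]]|[r []]]; first by exists r.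
by move=> ? ?; split=> //; exists r.
Qed.

Lemma is_path_inv T (p q : vertex T) w : involutive_automaton C T ->
  is_path p w q -> is_path q (inv_path w) p.
Proof.
move=> invT; elim: w p => [|e w IHw] p /=; first by move->.
move=> [<- /IHw path_w]; rewrite /inv_path /= rev_cons -cats1.
apply/is_path_cat; exists (tgt e) => //=.
by have [_ -> ->] := invT e.
Qed.

Lemma path_label_inv T (w : seq (edge T)) : involutive_automaton C T ->
  path_label (inv_path w) = (path_label w)^-1.
Proof.
move=> invT; elim: w => [|e w IHw]; first by rewrite /path_label !big_nil invg1.
rewrite /inv_path /= rev_cons -cats1 path_label_cat IHw !path_label_cons.
by rewrite /path_label big_nil mulg1 invgM; have [_ _ _ ->] := invT e.
Qed.

Lemma reduce_path T (p q : vertex T) w : involutive_automaton C T ->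
    is_path p w q ->
  exists w', [/\ is_path p w' q, reduced_path w' & path_label w' = path_label w].
Proof.
move=> invT; have [n] := ubnP (size w); elim: n w => // n IHn w.
rewrite ltnS => le_wn path_w.
have [red_w|] := pselect (reduced_path w); first by exists w.
move=> /existsNP[u /existsNP[v /existsNP[e /contrapT def_w]]].
have [||w' [path_w' red_w' lab_w']] := IHn (u ++ v).
- by apply: leq_trans le_wn; rewrite def_w !size_cat /= !addnS ltnS leqnSn.
- move: path_w; rewrite def_w => /is_path_cat[r path_u /= [src_e [_ path_v]]].
  apply/is_path_cat; exists r => //.
  by move: path_v; have [_ _ -> _ _] := invT e; rewrite src_e.
exists w'; split=> //; rewrite lab_w' def_w !path_label_cat !path_label_cons.
by have [_ _ _ -> _] := invT e; rewrite mulVKg.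
Qed.

Lemma recognized_closed_path T w : involutive_automaton C T ->
  is_path (base T) w (base T) -> recognized T (path_label w).
Proof.
by move=> invT /(reduce_path invT)[w' [? ? <-]]; exists w'.
Qed.

Lemma letter_val_inj l l' : C l.1 -> C l'.1 ->
  letter_val l = letter_val l' -> l = l'.
Proof.
move=> Cl Cl' eq_l; have [] : [:: l] = [:: l'] => //.
by apply: (free_word_uniq freeC); rewrite ?word_val1 //; apply/word_over_cons; split.
Qed.

Lemma letter_val_edge T (e : edge T) : letter_val (edge_letter e) = label e.
Proof.
by rewrite /edge_letter; case: ifP => _ //; rewrite /letter_val /= invgK.
Qed.

Lemma edge_letter_in T (e : edge T) : involutive_automaton C T ->
  C (edge_letter e).1.
Proof.
by move=> invT; rewrite /edge_letter; case: asboolP => // nCe; have [[]] := invT e.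
Qed.

Lemma path_word_over T (w : seq (edge T)) : involutive_automaton C T ->
  word_over C (map (@edge_letter T) w).
Proof.
move=> invT; elim: w => [|e w IHw] //=.
by apply/word_over_cons; split; first exact: edge_letter_in.
Qed.

Lemma path_word_val T (w : seq (edge T)) :
  word_val (map (@edge_letter T) w) = path_label w.
Proof.
by rewrite /word_val big_map; apply: eq_bigr => e _; rewrite letter_val_edge.
Qed.

(** By determinism, an edge that follows [e] and carries the inverse letter can only be [einv e]. *)
Lemma path_word_reduced T (p q : vertex T) w :
    involutive_automaton C T -> deterministic T -> is_path p w q ->
  reduced_path w -> reduced_word (map (@edge_letter T) w).
Proof.
move=> invT detT; elim: w p => [|e [|e' w] IHw] p // [_ path_w] red_w.
apply/andP; split; last first.
  by apply: IHw path_w _ => u v e'' def_w; apply: (red_w (e :: u) v e''); rewrite def_w.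
apply/eqP => eq_l; apply: (red_w [::] w e); congr [:: _, _ & _].
have [_ srcV _ labV _] := invT e.
apply: detT; last by left; rewrite srcV; case: path_w.
by rewrite labV -!letter_val_edge -letter_val_inv eq_l.
Qed.

(** A core edge of [K] is an edge of the automaton [U] and lifts to [T]. Trimness puts the lift on a
    reduced closed path, whose label is a reduced word of [H]; its image in [U] reaches the same
    vertex, that is, the same coset of [K]. *)
Lemma theta_onto_core H K : is_subgroup K ->
  theta_onto C H K -> core_onto C H K.
Proof.
move=> sgK [T [U [f [[[invT _ detT [_ trimT]] recT] [[invU _ detU _] recU]]]]].
move=> [_ ontoE] g l [u [v [[Cw red_w Kw] Kg]]].
move: Kw; rewrite -recU => -[a [path_a red_a lab_a]].
have def_a : map (@edge_letter U) a = u ++ l :: v.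
  apply: (free_word_uniq freeC) => //; first exact: path_word_over.
    exact: path_word_reduced path_a red_a.
  by rewrite path_word_val.
have [a1 [e [a2 [{}def_a a1_u e_l]]]] : exists a1 e a2,
    [/\ a = a1 ++ e :: a2, map (@edge_letter U) a1 = u & edge_letter e = l].
  elim: (u) a def_a {path_a red_a lab_a} => [|l1 u1 IHu] [|e a] //= [e_l1].
    by move=> _; exists [::], e, a.
  by move=> /IHu[a1 [e' [a2 [-> <- <-]]]]; exists (e :: a1), e', a2; rewrite -e_l1.
have [e' def_e] := ontoE e.
have [b1 [b2 [path_b red_b]]] := trimT e'.
have e'_l : edge_letter e' = l by rewrite -e_l -def_e /edge_letter hom_label.
exists (map (@edge_letter T) b1), (map (@edge_letter T) b2).
have -> : map (@edge_letter T) b1 ++ l :: map (@edge_letter T) b2 =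
    map (@edge_letter T) (b1 ++ e' :: b2) by rewrite map_cat /= e'_l.
split.
  split; [exact: path_word_over | exact: path_word_reduced path_b red_b |].
  by rewrite path_word_val -recT; exists (b1 ++ e' :: b2).
have hom_path (p q : vertex T) w : is_path p w q ->
    is_path (vmap f p) (map (emap f) w) (vmap f q).
  elim: w p => [|e2 w IHw] p /=; first by move->.
  by move=> [<- /IHw]; rewrite hom_src hom_tgt.
have hom_lab w : path_label (map (emap f) w) = path_label w.
  by rewrite /path_label big_map; apply: eq_bigr => e2 _; rewrite hom_label.
have Ka : K (word_val u * (path_label b1)^-1).
  rewrite -recU -a1_u path_word_val -hom_lab -path_label_inv // -path_label_cat.
  apply: recognized_closed_path => //; apply/is_path_cat; exists (src e).
    by move: path_a; rewrite def_a => /is_path_cat[r ? [->]].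
  apply: is_path_inv => //; rewrite -def_e hom_src -(hom_base f); apply: hom_path.
  by move: path_b => /is_path_cat[r ? [->]].
have := subgroupM sgK Kg Ka.
by rewrite path_word_val mulgA mulgVK recU.
Qed.

End AutomataPaths.

(** * Construction of Stallings automata and their homomorphisms from core edges *)

Section CoreAutomaton.
Variables (G : groupType) (C : set G).
Implicit Types (g x y : G) (l : G * bool) (p : set G).

Definition right_coset (H : set G) g : set G := [set x | H (x * g^-1)].

(** Right multiplication of a set by [x]; targets of edges are thus defined without choosing coset
    representatives. *)
Definition translate p x : set G := [set y | p (y * x^-1)].

Lemma right_coset_eqP H g h : is_subgroup H ->
  right_coset H g = right_coset H h <-> H (g * h^-1).
Proof.
move=> sgH; split=> [/seteqP[/(_ g) + _]|Hgh].
  by apply; rewrite /right_coset /= mulgV; apply: subgroup1.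
apply/seteqP; split=> x /= Hx.
  by have := subgroupM sgH Hx Hgh; rewrite mulgA mulgVK.
have := subgroupM sgH Hx (subgroupV sgH Hgh).
by rewrite invgM invgK mulgA mulgVK.
Qed.

Lemma translate_coset H g x :
  translate (right_coset H g) x = right_coset H (g * x).
Proof.
by apply/seteqP; split=> y /=; rewrite /right_coset /translate /= invgM mulgA.
Qed.

Lemma translateM p x y : translate (translate p x) y = translate p (x * y).
Proof. by apply/seteqP; split=> z /=; rewrite /translate /= invgM mulgA. Qed.

Lemma translate1 p : translate p 1 = p.
Proof. by apply/seteqP; split=> z /=; rewrite /translate /= invg1 mulg1. Qed.

Lemma sig_eq (T : Type) (P : T -> Prop) (a b : {x | P x}) :
  sval a = sval b -> a = b.
Proof.
case: a b => x Px [y Py] /= eq_xy; case: _ / eq_xy Py => Px'.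
by congr exist; apply: Prop_irrelevance.
Qed.

Section Construction.
Variable H : set G.
Hypothesis sgH : is_subgroup H.

(** The basepoint is listed separately because the trivial subgroup has no core edge. *)
Definition core_vertexP p :=
  p = right_coset H 1 \/ exists g l, core_edge C H H g l /\ p = right_coset H g.

Definition core_edgeP (e : set G * (G * bool)) :=
  exists2 g, core_edge C H H g e.2 & e.1 = right_coset H g.

Lemma core_edge_src e : core_edgeP e -> core_vertexP e.1.
Proof. by move=> [g e_g ->]; right; exists g, e.2. Qed.

Lemma core_edge_inv e : core_edgeP e ->
  core_edgeP (translate e.1 (letter_val e.2), inv_letter e.2).
Proof.
move=> [g e_g ->]; exists (g * letter_val e.2) => /=; last exact: translate_coset.
by have [+ _] := core_edge_schreier C sgH sgH (@subset_refl _ H); apply.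
Qed.

Lemma core_edge_tgt e : core_edgeP e ->
  core_vertexP (translate e.1 (letter_val e.2)).
Proof. by move/core_edge_inv/core_edge_src. Qed.

Lemma core_base : core_vertexP (right_coset H 1).
Proof. by left. Qed.

Definition core_automaton : automaton G := {|
  vertex := {p | core_vertexP p};
  edge := {e | core_edgeP e};
  src := fun e => exist _ _ (core_edge_src (svalP e));
  tgt := fun e => exist _ _ (core_edge_tgt (svalP e));
  label := fun e => letter_val (sval e).2;
  einv := fun e => exist _ _ (core_edge_inv (svalP e));
  base := exist _ _ core_base |}.

Local Notation T := core_automaton.

Definition core_letter (e : edge T) := (sval e).2.

Lemma core_letter_in (e : edge T) : C (core_letter e).1.
Proof. by have [g e_g _] := svalP e; apply: core_edge_over e_g. Qed.

Lemma core_involutive : involutive_automaton C T.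
Proof.
move=> e; split=> /=.
- have := core_letter_in e; rewrite /core_letter /letter_val.
  by case: (_.2.2) => Ce; [left | right; rewrite invgK].
- exact: sig_eq.
- by apply: sig_eq; rewrite /= letter_val_inv translateM mulgV translate1.
- by rewrite letter_val_inv.
apply: sig_eq; case: e => -[p l] Pe /=.
by rewrite letter_val_inv translateM mulgV translate1 inv_letterK.
Qed.

Lemma core_deterministic : free_set C -> deterministic T.
Proof.
move=> freeC e e' /= eq_l eq_v; apply: sig_eq.
have := letter_val_inj freeC (core_letter_in e) (core_letter_in e') eq_l.
case: e e' {eq_l} eq_v => -[p l] Pe [[p' l'] Pe'] /= + eq_l.
rewrite /core_letter /= in eq_l; subst l'.
move=> [] /(congr1 sval) /= => [->|] //.
(* Equal targets: translating back by the common letter gives equal sources. *)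
move=> /(congr1 (translate ^~ (letter_val l)^-1)).
by rewrite !translateM mulgV !translate1 => ->.
Qed.

Lemma core_path_word (w : seq (edge T)) :
  path_label w = word_val (map core_letter w).
Proof. by rewrite /word_val big_map. Qed.

Lemma core_path_end (p q : vertex T) w : is_path p w q ->
  sval q = translate (sval p) (path_label w).
Proof.
elim: w p => [|e w IHw] p /=.
  by move->; rewrite /path_label big_nil translate1.
by move=> [<- /IHw ->] /=; rewrite translateM path_label_cons.
Qed.

Lemma core_path_exists g w (p : vertex T) :
    traced (core_edge C H H) g w -> sval p = right_coset H g ->
  exists a q, [/\ is_path p a q, sval q = right_coset H (g * word_val w)
    & map core_letter a = w].
Proof.
elim: w g p => [|l w IHw] g p /=.
  by move=> _ p_g; exists [::], p; rewrite word_val_nil mulg1.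
move=> [e_g w_g] p_g.
have Pe : core_edgeP (right_coset H g, l) by exists g.
pose e : edge T := exist _ _ Pe.
have [|a [q [path_a q_w a_w]]] := IHw _ (tgt e) w_g.
  exact: translate_coset.
exists (e :: a), q; split=> /=; last by rewrite a_w.
  by split=> //; apply: sig_eq.
by rewrite q_w word_val_cons mulgA.
Qed.

Lemma core_path_reduced (w : seq (edge T)) :
  reduced_word (map core_letter w) -> reduced_path w.
Proof.
move=> red_w u v e def_w; move: red_w.
rewrite def_w map_cat => /cat_sorted2[_] /=.
by rewrite -/(inv_letter _) eqxx.
Qed.

Lemma core_word_split u v : reduced_words C H (u ++ v) ->
  exists a b q, [/\ is_path (base T) a q, is_path q b (base T),
    map core_letter a = u, map core_letter b = v
  & sval q = right_coset H (word_val u)].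
Proof.
move=> Hw; have := word_edge_traced sgH Hw.
rewrite -/(core_edge C H H) traced_cat => -[Tu Tv].
have [a [q [path_a q_u a_u]]] := core_path_exists (p := base T) Tu erefl.
have [b [q' [path_b q'_v b_v]]] := core_path_exists Tv q_u.
exists a, b, q; split=> //; last by rewrite q_u mul1g.
suff <- : q' = base T by [].
apply: sig_eq; rewrite q'_v mul1g -word_val_cat; apply/right_coset_eqP => //.
by rewrite invg1 mulg1; case: Hw.
Qed.

Lemma core_vertex_path (p : vertex T) : p = base T \/
  exists g l a b, [/\ sval p = right_coset H g, core_edge C H H g l,
    is_path (base T) a p, is_path p b (base T) & reduced_path (a ++ b)].
Proof.
case: (svalP p) => [p_1|[g [l [e_g p_g]]]]; first by left; apply: sig_eq.
right; have [u [v [Hw Hg]]] := e_g.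
have [a [b [q [path_a path_b a_u b_v q_u]]]] := core_word_split Hw.
have def_q : q = p.
  by apply: sig_eq; rewrite q_u p_g; apply/esym/right_coset_eqP.
rewrite def_q in path_a path_b.
exists g, l, a, b; split=> //; apply: core_path_reduced.
by rewrite map_cat a_u b_v; case: Hw.
Qed.

Lemma core_connected : connected_automaton T.
Proof.
have from_base (p : vertex T) : exists w, is_path (base T) w p.
  have [->|[g [l [a [_ [_ _ path_a _ _]]]]]] := core_vertex_path p.
    by exists [::].
  by exists a.
move=> p q; have [u path_u] := from_base p; have [v path_v] := from_base q.
exists (inv_path u ++ v); apply/is_path_cat; exists (base T) => //.
exact: is_path_inv core_involutive path_u.
Qed.

Lemma core_trim : trim T.
Proof.
split=> [p|e].
  have [->|[g [l [a [b [_ _ path_a path_b red_ab]]]]]] := core_vertex_path p.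
    by exists [::], [::]; split=> // -[].
  by exists a, b.
case: (svalP e) => g [u [v [Hw Hg]]] e_g.
have [a [b' [q [path_a path_b a_u b_v q_u]]]] := core_word_split Hw.
case: b' path_b b_v => [|e' b] //= [src_e' path_b] [e'_l b_v].
have def_e : e' = e.
  apply: sig_eq; move: (congr1 sval src_e'); rewrite /= q_u => e'_u.
  rewrite [RHS]surjective_pairing e_g -e'_l [LHS]surjective_pairing e'_u.
  by congr (_, _); apply/esym/right_coset_eqP.
rewrite -{}def_e.
exists a, b; split; first by apply/is_path_cat; exists q.
by apply: core_path_reduced; rewrite map_cat /= a_u b_v e'_l; case: Hw.
Qed.

Lemma core_recognized : H `<=` generated C -> recognized T = H.
Proof.
move=> sHC; apply/seteqP; split=> [_ [w [path_w _ <-]]|h Hh].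
  have := core_path_end path_w; rewrite /= translate_coset mul1g.
  move=> /esym/(right_coset_eqP _ _ sgH).
  by rewrite invg1 mulg1.
have /reduced_generatedP[w [Cw red_w val_w]] := sHC h Hh.
have [|a [b [q]]] := core_word_split (u := w) (v := [::]).
  by rewrite cats0; split; rewrite ?val_w.
case: b => [|e b] [] // path_a q_1 a_w _ _; rewrite q_1 in path_a.
exists a; split=> //.
  by apply: core_path_reduced; rewrite a_w.
by rewrite -val_w -a_w -core_path_word.
Qed.

Lemma core_Stallings : free_set C -> H `<=` generated C ->
  is_Stallings_of C H T.
Proof.
move=> freeC sHC; split; last exact: core_recognized.
split; [exact: core_involutive | exact: core_connected | | exact: core_trim].
exact: core_deterministic.
Qed.

End Construction.

Section CoreHom.
Variables H K : set G.
Hypotheses (sgH : is_subgroup H) (sgK : is_subgroup K) (sHK : H `<=` K).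

(** The product of [K] with [p], which sends the coset of [g] modulo [H] to its coset modulo [K]
    without a choice of [g]. *)
Definition coset_extend p : set G := [set x | exists2 y, p y & K (x * y^-1)].

Lemma coset_extend_coset g : coset_extend (right_coset H g) = right_coset K g.
Proof.
apply/seteqP; split=> [x [y Hy Kxy]|x Kx] /=.
  by have := subgroupM sgK Kxy (sHK Hy); rewrite mulgA mulgVK.
by exists g => //=; rewrite /right_coset /= mulgV; apply: subgroup1.
Qed.

Lemma coset_extend_translate p x :
  coset_extend (translate p x) = translate (coset_extend p) x.
Proof.
apply/seteqP; split=> z [y py Kzy].
  by exists (y * x^-1) => //; rewrite invgM invgK mulgA mulgVK.
exists (y * x); first by rewrite /translate /= mulgK.
by rewrite invgM mulgA.
Qed.

Lemma core_edge_extend g l : core_edge C H H g l -> core_edge C K K g l.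
Proof.
move=> /(core_edge_sub sHK)[u [v [Kw Hg]]]; exists u, v; split=> //.
exact: sHK.
Qed.

Lemma core_vertex_extend p : core_vertexP H p -> core_vertexP K (coset_extend p).
Proof.
move=> [->|[g [l [e_g ->]]]]; rewrite coset_extend_coset; first by left.
by right; exists g, l; split=> //; apply: core_edge_extend.
Qed.

Lemma core_edgeP_extend e : core_edgeP H e ->
  core_edgeP K (coset_extend e.1, e.2).
Proof.
move=> [g e_g ->]; exists g; first exact: core_edge_extend.
by rewrite /= coset_extend_coset.
Qed.

Definition core_hom : automaton_hom (core_automaton sgH) (core_automaton sgK).
Proof.
refine (@AutomatonHom _ (core_automaton sgH) (core_automaton sgK)
  (fun p : vertex (core_automaton sgH) =>
     exist _ _ (core_vertex_extend (svalP p)))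
  (fun e : edge (core_automaton sgH) =>
     exist _ _ (core_edgeP_extend (svalP e))) _ _ _ _).
- by move=> e; apply: sig_eq.
- by move=> e; apply: sig_eq; rewrite /= coset_extend_translate.
- by [].
- by apply: sig_eq; rewrite /= coset_extend_coset.
Defined.

Lemma core_hom_onto : core_onto C H K -> onto_hom core_hom.
Proof.
move=> onto.
have ontoE e' : exists e, emap core_hom e = e'.
  case: (svalP e') => g /onto[u [v [Hw Kg]]] e'_g.
  have Pe : core_edgeP H (right_coset H (word_val u), (sval e').2).
    exists (word_val u) => //; exists u, v; split=> //.
    by rewrite mulgV; apply: subgroup1.
  exists (exist _ _ Pe); apply: sig_eq; rewrite /= coset_extend_coset.
  rewrite [RHS]surjective_pairing e'_g; congr (_, _).
  by apply/esym/right_coset_eqP.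
(* A vertex that is not the basepoint is the source of a core edge, so surjectivity on edges gives
   it a preimage. *)
split=> // q; case: (svalP q) => [q_1|[g [l [e_g q_g]]]].
  by exists (base (core_automaton sgH)); rewrite hom_base; apply: sig_eq.
have Pe : core_edgeP K (right_coset K g, l) by exists g.
have [e def_e] := ontoE (exist _ _ Pe).
by exists (src e); rewrite -hom_src def_e; apply: sig_eq.
Qed.

Lemma core_onto_theta : free_set C -> K `<=` generated C ->
  core_onto C H K -> theta_onto C H K.
Proof.
move=> freeC sKC onto.
exists (core_automaton sgH), (core_automaton sgK), core_hom; split.
- by apply: core_Stallings => //; apply: subset_trans sKC.
- exact: core_Stallings.
- exact: core_hom_onto.
Qed.

End CoreHom.
End CoreAutomaton.

(** * Images in larger groups and closures *)

Section Images.
Variables (F FB : groupType) (j : {multiplicative F -> FB}).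
Hypothesis inj_j : injective j.
Implicit Types (H K L X : set F).

Lemma multiplicative1 : j 1 = 1.
Proof. by apply: (@mulgI _ (j 1)); rewrite -gmulfM !mulg1. Qed.

Lemma multiplicativeV x : j x^-1 = (j x)^-1.
Proof. by apply/esym/mulg1_eq; rewrite -gmulfM mulgV multiplicative1. Qed.

Lemma image_subgroup H : is_subgroup H -> is_subgroup (j @` H).
Proof.
move=> sgH; split=> [|_ _ [x Hx <-] [y Hy <-]|_ [x Hx <-]].
- by exists 1; [apply: subgroup1 | apply: multiplicative1].
- by exists (x * y); [apply: subgroupM | apply: gmulfM].
- by exists x^-1; [apply: subgroupV | apply: multiplicativeV].
Qed.

Lemma preimage_subgroup (H : set FB) : is_subgroup H -> is_subgroup (j @^-1` H).
Proof.
move=> sgH; split=> [|x y Hx Hy|x Hx] /=.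
- by rewrite /preimage /= multiplicative1; apply: subgroup1.
- by rewrite /preimage /= gmulfM; apply: subgroupM.
- by rewrite /preimage /= multiplicativeV; apply: subgroupV.
Qed.

Lemma image_generated X : j @` generated X = generated (j @` X).
Proof.
apply/seteqP; split=> [_ [x genx <-]|]; last first.
  apply: generated_min => [|_ [x Xx <-]].
    exact/image_subgroup/generated_subgroup.
  by exists x => //; apply: generated_sub.
have sub : generated X `<=` j @^-1` generated (j @` X).
  apply: generated_min => [|y Xy]; first exact/preimage_subgroup/generated_subgroup.
  by apply: generated_sub; exists y.
exact: sub.
Qed.

Lemma extension_image H K : extension H K -> extension (j @` H) (j @` K).
Proof.
move=> [sgH sgK sHK]; split; [exact: image_subgroup..|].
exact: image_subset.
Qed.

Lemma preimage_image_inj K : j @^-1` (j @` K) = K.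
Proof.
by apply/seteqP; split=> [x [y Ky /inj_j <-]|x Kx] //; exists x.
Qed.

Lemma image_preimage_range (X : set FB) : X `<=` range j -> j @` (j @^-1` X) = X.
Proof.
move=> sXj; apply/seteqP; split=> [_ [x Xx <-]|y Xy] //.
by have [x _ def_y] := sXj y Xy; exists x; rewrite /preimage /= ?def_y.
Qed.

Lemma basis_preimage (X L : set FB) : X `<=` range j -> is_basis X L ->
  is_basis (j @^-1` X) (j @^-1` L).
Proof.
move=> sXj [freeX <-]; split; last first.
  by rewrite -[in RHS](image_preimage_range sXj) -image_generated preimage_image_inj.
pose jl (l : F * bool) := (j l.1, l.2).
have jlE l : letter_val (jl l) = j (letter_val l).
  by rewrite /letter_val /jl /=; case: l.2; rewrite ?multiplicativeV.
have inj_jl : injective jl by case=> x b [y c] [/inj_j -> ->].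
move=> w Xw red_w val_w; suff : map jl w = [::] by case: (w).
apply: freeX.
- by move=> _ /mapP[l w_l ->]; apply: Xw.
- rewrite /reduced_word sorted_map; case: w red_w {Xw val_w} => //= l w.
  by congr is_true; apply: eq_path => a b; rewrite -(inj_eq inj_jl).
rewrite big_map -[RHS]multiplicative1 -val_w; elim: (w) => [|l s IHs].
  by rewrite !big_nil multiplicative1.
by rewrite !big_cons gmulfM -IHs jlE.
Qed.

(** A free factor of the image of [K], together with its bases, lies in the range of [j], so it
    pulls back to a free factor of [K]. *)
Lemma algebraic_image H K : algebraic H K -> algebraic (j @` H) (j @` K).
Proof.
move=> [extHK minK]; split; first exact: extension_image.
move=> L ffL sHL; have [_ _ sLK] := free_factor_sub ffL.
have sjK : j @` K `<=` range j by move=> _ [x _ <-]; exists x.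
have sLj := subset_trans sLK sjK.
have [X [Y [bX bY sXY]]] := ffL.
have sYj : Y `<=` range j.
  by apply: subset_trans sjK; case: bY => _ <-; apply: generated_sub.
rewrite -(image_preimage_range sLj) (minK (j @^-1` L)) //.
  exists (j @^-1` X), (j @^-1` Y); split.
    exact: basis_preimage (subset_trans sXY sYj) bX.
    by rewrite -(preimage_image_inj K); apply: basis_preimage.
  by move=> x; apply: sXY.
by move=> x Hx; apply: sHL; exists x.
Qed.

End Images.

(** * Closures for a class of extensions stable under composition and joins *)

Section Closures.
Variables (F : groupType) (C : set F).
Hypotheses (freeC : free_set C) (genC : generated C = [set: F]).
Implicit Types (H K L : set F) (D : set (set F)).

Lemma sub_genC K : K `<=` generated C.
Proof. by rewrite genC. Qed.

Section ExtensionClass.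
(* The common properties of onto and of fully onto extensions. *)
Variable E : set F -> set F -> Prop.
Hypothesis E_ext : forall H K, E H K -> extension H K.
Hypothesis E_core : forall H K, E H K -> core_onto C H K.
Hypothesis E_alg : forall H K, algebraic H K -> E H K.
Hypothesis E_trans : forall H L K, E H L -> E L K -> E H K.
Hypothesis E_join : forall H D, D H -> (forall L, D L -> E H L) ->
  E H (generated (\bigcup_(L in D) L)).

(** [onto_closure] and [fully_onto_closure] are the instances for [onto_ext] and [fully_onto_ext],
    by conversion. *)
Definition closure_in K H : set F :=
  generated (\bigcup_(L in [set L | E H L /\ L `<=` K]) L).

Lemma algebraic_refl H : is_subgroup H -> algebraic H H.
Proof.
move=> sgH; split; first by split.
by move=> L /free_factor_sub[_ _ sLH] sHL; apply/seteqP.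
Qed.

Lemma sub_closure K H L : E H L -> L `<=` K -> L `<=` closure_in K H.
Proof. by move=> EHL sLK x Lx; apply: generated_sub; exists L. Qed.

Lemma closure_ext K H : extension H K -> E H (closure_in K H).
Proof.
move=> [sgH sgK sHK]; apply: E_join => [|L []//].
by split=> //; apply/E_alg/algebraic_refl.
Qed.

Lemma closure_sub K H : is_subgroup K -> closure_in K H `<=` K.
Proof. by move=> sgK; apply: generated_min => // x [L [_ sLK] /sLK]. Qed.

Lemma closure_free_factor K H : extension H K -> finitely_generated H ->
  free_factor (closure_in K H) K.
Proof.
move=> extHK fgH; have EHcl := closure_ext extHK.
have [sgH sgK sHK] := extHK; have [_ sgcl sHcl] := E_ext EHcl.
have sclK := closure_sub (H := H) sgK.
have fgcl := core_onto_finitely_generated freeC sgH sgcl sHcl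
  (@sub_genC _) fgH (E_core EHcl).
have [L [algL ffL]] := algebraic_free_factor freeC (And3 sgcl sgK sclK)
  (@sub_genC _) fgcl.
have [_ _ sclL] := algL.1; have [_ _ sLK] := free_factor_sub ffL.
suff -> : closure_in K H = L by [].
apply/seteqP; split=> //; apply: sub_closure => //.
exact: E_trans EHcl (E_alg algL).
Qed.

End ExtensionClass.
End Closures.

(** * Onto and fully onto extensions in terms of core edges *)

Section OntoExtensions.
Variables (F : groupType) (A : set F).
Implicit Types (H K L : set F) (D : set (set F)).

(** The bridge between automata and words; through it both kinds of ontoness become statements about
    core edges over every basis. *)
Lemma theta_ontoP (G : groupType) (C H K : set G) : is_basis C [set: G] ->
  extension H K -> theta_onto C H K <-> core_onto C H K.
Proof.
move=> [freeC genC] [sgH sgK sHK]; split; first exact: theta_onto_core.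
by apply: core_onto_theta; rewrite // genC.
Qed.

Lemma onto_extP H K : onto_ext H K <-> extension H K /\
  forall A', is_basis A' [set: F] -> core_onto A' H K.
Proof.
by split=> -[extHK ontoHK]; split=> // A' basisA'; apply/theta_ontoP => //;
  apply: ontoHK.
Qed.

Lemma fully_onto_extP H K : fully_onto_ext A H K <-> extension H K /\
  forall (FB : groupType) (B : set FB) (j : {multiplicative F -> FB}),
    is_basis B [set: FB] -> injective j -> j @` A `<=` B ->
    forall B', is_basis B' [set: FB] -> core_onto B' (j @` H) (j @` K).
Proof.
split=> -[extHK ontoHK]; split=> // FB B j basisB inj_j sAB B' basisB';
  apply/theta_ontoP; rewrite //; try exact: extension_image;
  exact: ontoHK basisB inj_j sAB _ basisB'.
Qed.

Lemma onto_ext_algebraic H K : algebraic H K -> onto_ext H K.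
Proof.
move=> algHK; apply/onto_extP; split=> [|A' [freeA' genA']]; first exact: algHK.1.
by apply: algebraic_core_onto => //; rewrite genA'.
Qed.

Lemma onto_ext_trans H L K : onto_ext H L -> onto_ext L K -> onto_ext H K.
Proof.
move=> /onto_extP[[sgH sgL sHL] HL] /onto_extP[[_ sgK sLK] LK].
apply/onto_extP; split=> [|A' basisA']; first by split=> //; apply: subset_trans sLK.
exact: core_onto_trans (HL _ basisA') (LK _ basisA').
Qed.

Lemma onto_ext_subl H L K :
  H `<=` L -> extension L K -> onto_ext H K -> onto_ext L K.
Proof.
move=> sHL extLK /onto_extP[_ HK]; apply/onto_extP; split=> // A' basisA'.
exact: core_onto_subl (HK _ basisA').
Qed.

Lemma extension_join H D : D H -> (forall L, D L -> extension H L) ->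
  extension H (generated (\bigcup_(L in D) L)).
Proof.
move=> DH extD; split; [by have [] := extD H DH | exact: generated_subgroup |].
by move=> x Hx; apply: generated_sub; exists H.
Qed.

Lemma onto_ext_join H D : D H -> (forall L, D L -> onto_ext H L) ->
  onto_ext H (generated (\bigcup_(L in D) L)).
Proof.
move=> DH ontoD; apply/onto_extP; split.
  by apply: extension_join => // L /ontoD[].
move=> A' basisA'; have [freeA' genA'] := basisA'.
have [[sgH _ _] _] := ontoD H DH.
apply: core_onto_join => // [|L /ontoD/onto_extP[[_ sgL sHL] HL]].
  by rewrite genA'.
by split=> //; apply: HL.
Qed.

Lemma fully_onto_ext_algebraic H K : algebraic H K -> fully_onto_ext A H K.
Proof.
move=> algHK; apply/fully_onto_extP; split; first exact: algHK.1.
move=> FB B j basisB inj_j sAB B' [freeB' genB'].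
by apply: algebraic_core_onto => //; [rewrite genB' | apply: algebraic_image].
Qed.

Lemma fully_onto_ext_trans H L K :
  fully_onto_ext A H L -> fully_onto_ext A L K -> fully_onto_ext A H K.
Proof.
move=> /fully_onto_extP[[sgH sgL sHL] HL] /fully_onto_extP[[_ sgK sLK] LK].
apply/fully_onto_extP; split; first by split=> //; apply: subset_trans sLK.
move=> FB B j basisB inj_j sAB B' basisB'.
apply: core_onto_trans (HL _ _ _ basisB inj_j sAB _ basisB')
  (LK _ _ _ basisB inj_j sAB _ basisB'); try exact: image_subgroup.
exact: image_subset.
Qed.

Lemma fully_onto_ext_subl H L K :
  H `<=` L -> extension L K -> fully_onto_ext A H K -> fully_onto_ext A L K.
Proof.
move=> sHL extLK /fully_onto_extP[_ HK]; apply/fully_onto_extP; split=> //.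
move=> FB B j basisB inj_j sAB B' basisB'.
apply: core_onto_subl (HK _ _ _ basisB inj_j sAB _ basisB').
exact: image_subset.
Qed.

Lemma fully_onto_ext_join H D : D H -> (forall L, D L -> fully_onto_ext A H L) ->
  fully_onto_ext A H (generated (\bigcup_(L in D) L)).
Proof.
move=> DH ontoD; apply/fully_onto_extP; split.
  by apply: extension_join => // L /ontoD[].
move=> FB B j basisB inj_j sAB B' basisB'; have [freeB' genB'] := basisB'.
have [[sgH _ _] _] := ontoD H DH.
(* The image of the join is turned into the join of the family of images, to which [core_onto_join]
   applies. *)
rewrite image_generated // image_bigcup -(bigcup_image D (fun L => j @` L) id).
apply: core_onto_join => //.
- exact: image_subgroup.
- by exists H.
- by rewrite genB'.
move=> _ [L /ontoD/fully_onto_extP[[_ sgL sHL] HL] <-].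
split; [exact: image_subgroup | exact: image_subset | exact: HL basisB inj_j sAB _ _].
Qed.

Lemma fully_onto_ext_onto H K : is_basis A [set: F] ->
  fully_onto_ext A H K -> onto_ext H K.
Proof.
move=> basisA [extHK ontoHK]; split=> // A' basisA'.
(* [F] serves as its own overgroup, with [B] equal to [A]. *)
have := ontoHK F A idfun basisA (@inj_id F) _ A' basisA'.
by rewrite !image_id; apply.
Qed.

End OntoExtensions.

Theorem proposition4p3 (F : groupType) (A H K : set F)
    (finA : finite_set A) (basisA : is_basis A [set: F])
    (subHK : extension H K) (fgH : finitely_generated H) :
  let Cl := alg_closure K H in
  let fOCl := fully_onto_closure A K H in
  let OCl := onto_closure K H in
  [/\ [/\ extension H Cl, extension Cl fOCl, extension fOCl OCl
        & extension OCl K],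
      algebraic H Cl,
      fully_onto_ext A Cl fOCl /\ free_factor Cl fOCl,
      onto_ext fOCl OCl /\ free_factor fOCl OCl
    & free_factor OCl K].
Proof.
move=> Cl fOCl OCl; have [freeA genA] := basisA; have [sgH sgK sHK] := subHK.
have onto_core L M : onto_ext L M -> core_onto A L M.
  by move/onto_extP => [_]; apply.
have fully_onto := fully_onto_ext_onto basisA.
have [algCl ffCl] : algebraic H Cl /\ free_factor Cl K.
  have sKA : K `<=` generated A by rewrite genA.
  (* Existence ensures that [alg_closure] is not the default [set0]. *)
  exact: (xgetPex set0 (algebraic_free_factor freeA subHK sKA fgH)).
have extHCl := algCl.1; have [_ sgCl sHCl] := extHCl.
have [_ _ sClK] := free_factor_sub ffCl.
have ontoOCl : onto_ext H OCl.
  exact: (closure_ext (@onto_ext_algebraic _) (@onto_ext_join _) subHK).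
have ontofOCl : fully_onto_ext A H fOCl.
  exact: (closure_ext (@fully_onto_ext_algebraic _ A) (@fully_onto_ext_join _ A) subHK).
have [[_ sgOCl _] _] := ontoOCl; have [[_ sgfOCl _] _] := ontofOCl.
have sfOCl : fOCl `<=` K by exact: closure_sub.
have sOCl : OCl `<=` K by exact: closure_sub.
have ffOCl : free_factor OCl K.
  have ext_onto (L M : set F) : onto_ext L M -> extension L M by case.
  exact: (closure_free_factor freeA genA ext_onto onto_core
    (@onto_ext_algebraic _) (@onto_ext_trans _) (@onto_ext_join _) subHK fgH).
have fffOCl : free_factor fOCl K.
  have ext_fully L M : fully_onto_ext A L M -> extension L M by case.
  have fully_core L M : fully_onto_ext A L M -> core_onto A L M.
    by move=> /fully_onto/onto_core.
  exact: (closure_free_factor freeA genA ext_fully fully_core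
    (@fully_onto_ext_algebraic _ A) (@fully_onto_ext_trans _ A)
    (@fully_onto_ext_join _ A) subHK fgH).
have sClfOCl : Cl `<=` fOCl.
  by apply: sub_closure => //; apply: fully_onto_ext_algebraic.
have sfOClOCl : fOCl `<=` OCl by apply: sub_closure => //; apply: fully_onto.
split=> //.
(* Full ontoness passes from [H] to the larger subgroup [Cl], whose core has a larger image; and
   [Cl], a free factor of [K] inside [fOCl], is a free factor of [fOCl]. The next pair is obtained
   in the same way. *)
- split; first exact: fully_onto_ext_subl sHCl _ ontofOCl.
  exact: free_factor_mid ffCl.
- split; last exact: free_factor_mid fffOCl.
  by apply: onto_ext_subl ontoOCl => //; apply: subset_trans sClfOCl.
Qed.
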